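(* Let $\ell,m,n$ be positive integers with $\gcd(\ell,m,n)=1$ such that the numerical semigroup $\Gamma=\langle\ell,m,n\rangle$ is in Herzog's case (H1) (defined in the context), with associated positive integers $a,b,c,a_1,a_2,b_1,b_2,c_1,c_2$. Let $\gamma$ be the conductor of $\Gamma$ and let $$d_1=a\ell,\qquad d_2=bm,\qquad d_3=cn .$$ Let $\Delta\ell,\Delta m,\Delta n\in\{1,2,\dots\}\cup\{\infty\}$ and consider three elements of $\mathbb{K}[t,s]$ of the form $$\xi=t^\ell+\sum_{i\ge\ell+\Delta\ell}\xi_i s^{i-\ell}t^i,\quad \eta=t^m+\sum_{i\ge m+\Delta m}\eta_i s^{i-m}t^i,\quad \zeta=t^n+\sum_{i\ge n+\Delta n}\zeta_i s^{i-n}t^i$$ with $\xi_i,\eta_i,\zeta_i\in\mathbb{K}$. Let $C$ be the curve germ with ring $\mathcal{O}_C=\mathbb{K}\{\xi(t,1),\eta(t,1),\zeta(t,1)\}\subset\mathbb{K}\{t\}$. Set $\delta=\min(\Delta\ell,\Delta m,\Delta n)$ and $k=a_1c_2$. Then $C$ is a set-theoretic complete intersection if $$\min(d_1,d_2,d_3)+\delta\ge\gamma\quad\text{and}\quad \min(d_1,d_3)+\delta\ge\gamma+k\ell,$$ or, equivalently, if $$\min(d_1,\,d_2+k\ell,\,d_3)+\delta\ge\gamma+k\ell .$$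
   Context: $\mathbb{K}$ is an algebraically closed field complete with respect to a non-discrete (i.e. non-trivial) absolute value; $\mathbb{K}\{\cdot\}$ denotes convergent power series, and $\mathbb{K}\{\xi',\eta',\zeta'\}\subset\mathbb{K}\{t\}$ is the image of $\mathbb{K}\{x,y,z\}\to\mathbb{K}\{t\}$, $(x,y,z)\mapsto(\xi',\eta',\zeta')$. $\mathbb{N}=\{0,1,2,\dots\}$. Case (H1): let $a,b,c$ be the minimal positive integers such that $$a\ell=b_1m+c_2n,\quad bm=a_2\ell+c_1n,\quad cn=a_1\ell+b_2m$$ for some $a_1,a_2,b_1,b_2,c_1,c_2\in\mathbb{N}$. Case (H1) means that $0\notin\{a_1,a_2,b_1,b_2,c_1,c_2\}$; then $a=a_1+a_2$, $b=b_1+b_2$, $c=c_1+c_2$ (Herzog), these integers are uniquely determined, and the kernel of $\mathbb{K}[x,y,z]\to\mathbb{K}[t]$, $(x,y,z)\mapsto(t^\ell,t^m,t^n)$, is generated by $f_1=x^a-y^{b_1}z^{c_2}$, $f_2=y^b-x^{a_2}z^{c_1}$, $f_3=x^{a_1}y^{b_2}-z^c$. The integers $d_1,d_2,d_3$ are the weighted degrees of $f_1,f_2,f_3$ with respect to $\deg(x,y,z)=(\ell,m,n)$. The conductor of $\Gamma$ is the least $\gamma\in\mathbb{N}$ with $\gamma+\mathbb{N}\subset\Gamma$. If $\Delta\ell=\infty$ the corresponding sum is empty (similarly for $\Delta m$, $\Delta n$). $C$ is a space curve germ via $x,y,z\mapsto \xi(t,1),\eta(t,1),\zeta(t,1)$.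 It is a set-theoretic complete intersection if its ideal $P\subset\mathbb{K}\{x,y,z\}$ (of height 2) is the radical of an ideal generated by two elements. *)

(* Defs.v *)
From HB Require Import structures.
From mathcomp Require Import all_boot all_order all_algebra.
From mathcomp Require Import boolp classical_sets reals mpoly.

Set Implicit Arguments.
Unset Strict Implicit.
Unset Printing Implicit Defensive.

Import Order.TTheory GRing.Theory Num.Theory.

Local Open Scope ring_scope.

Structure absvalue (K : fieldType) (R : realType) := AbsValue {
  absv :> K -> R;
  absv_ge0 : forall x, 0 <= absv x;
  absv_eq0 : forall x, absv x = 0 <-> x = 0;
  absvM : forall x y, absv (x * y) = absv x * absv y;
  absv_triangle : forall x y, absv (x + y) <= absv x + absv y
}.

Definition absv_nontrivial (K : fieldType) (R : realType)
    (abs : absvalue K R) : Prop :=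
  exists x, x <> 0 /\ abs x <> 1.

Definition absv_complete (K : fieldType) (R : realType)
    (abs : absvalue K R) : Prop :=
  forall u : nat -> K,
    (forall e : R, 0 < e -> exists N : nat, forall i j : nat,
       (N <= i)%N -> (N <= j)%N -> abs (u i - u j) < e) ->
    exists l : K, forall e : R, 0 < e -> exists N : nat, forall i : nat,
       (N <= i)%N -> abs (u i - l) < e.

(* A formal power series is its family of coefficients, indexed by the
   monomials of mpoly; the product mirrors mcoeffM. *)
Record fpser (n : nat) (K : comNzRingType) := FPSer {
  fps_coef :> 'X_{1..n} -> K
}.

Section FormalPowerSeries.
Variables (n : nat) (K : comNzRingType).
Implicit Types (f g h : fpser n K) (m : 'X_{1..n}).

HB.instance Definition _ := gen_eqMixin (fpser n K).
HB.instance Definition _ := gen_choiceMixin (fpser n K).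

Lemma fpserP f g : (forall m, f m = g m) -> f = g.
Proof. by case: f g => [f] [g] /= /funext ->. Qed.

Definition fps_zero : fpser n K := FPSer (fun=> 0).
Definition fps_opp f : fpser n K := FPSer (fun m => - f m).
Definition fps_add f g : fpser n K := FPSer (fun m => f m + g m).
Definition fps_one : fpser n K := FPSer (fun m => (m == 0%MM)%:R).
Definition fps_mul f g : fpser n K := FPSer (fun m =>
  \sum_(k : 'X_{1..n < (mdeg m).+1, (mdeg m).+1} | m == (k.1 + k.2)%MM)
     f k.1 * g k.2).

Definition fps_trunc (N : nat) f : {mpoly K[n]} :=
  \sum_(m : 'X_{1..n < N}) f m *: 'X_[m].

Lemma mcoeff_trunc N f m : (mdeg m < N)%N -> (fps_trunc N f)@_m = f m.
Proof. by move=> mN; rewrite mcoeff_mpoly. Qed.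

Lemma fps_mul_trunc N f g m : (mdeg m < N)%N ->
  fps_mul f g m = (fps_trunc N f * fps_trunc N g)@_m.
Proof.
move=> mN; rewrite mcoeffM; apply: eq_bigr => -[k1 k2] /= /eqP Em.
have lN : (mdeg k1 + mdeg k2 < N)%N by rewrite -mdegD -Em.
by rewrite !mcoeff_trunc //; apply: leq_ltn_trans lN;
  rewrite ?leq_addr ?leq_addl.
Qed.

Lemma fps_mulE N f g m : (mdeg m < N)%N ->
  fps_mul f g m =
  \sum_(k : 'X_{1..n < N, N} | m == (k.1 + k.2)%MM) f k.1 * g k.2.
Proof.
move=> mN; rewrite (fps_mul_trunc _ _ mN) (mcoeff_poly_mul _ _ mN).
by apply: eq_bigr => -[k1 k2] /= _; rewrite !mcoeff_trunc ?bmdeg.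
Qed.

Lemma fps_trunc_mul N f g m : (mdeg m < N)%N ->
  (fps_trunc N (fps_mul f g))@_m = (fps_trunc N f * fps_trunc N g)@_m.
Proof. by move=> mN; rewrite mcoeff_trunc // (fps_mul_trunc _ _ mN). Qed.

Lemma eq_mcoeffM N (p p' q q' : {mpoly K[n]}) m : (mdeg m < N)%N ->
  (forall k, (mdeg k < N)%N -> p@_k = p'@_k) ->
  (forall k, (mdeg k < N)%N -> q@_k = q'@_k) ->
  (p * q)@_m = (p' * q')@_m.
Proof.
move=> mN Hp Hq; rewrite !mcoeffM; apply: eq_bigr => -[k1 k2] /= /eqP Em.
have lN : (mdeg k1 + mdeg k2 < N)%N by rewrite -mdegD -Em.
rewrite Hp ?Hq //; apply: leq_ltn_trans lN; by rewrite ?leq_addr ?leq_addl.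
Qed.

Fact fps_addA : associative fps_add.
Proof. by move=> f g h; apply: fpserP => m /=; rewrite addrA. Qed.
Fact fps_addC : commutative fps_add.
Proof. by move=> f g; apply: fpserP => m /=; rewrite addrC. Qed.
Fact fps_add0 : left_id fps_zero fps_add.
Proof. by move=> f; apply: fpserP => m /=; rewrite add0r. Qed.
Fact fps_addN : left_inverse fps_zero fps_opp fps_add.
Proof. by move=> f; apply: fpserP => m /=; rewrite addNr. Qed.

HB.instance Definition _ :=
  GRing.isZmodule.Build (fpser n K) fps_addA fps_addC fps_add0 fps_addN.

Fact fps_mulA : associative fps_mul.
Proof.
move=> f g h; apply: fpserP => m; pose N := (mdeg m).+1.
have mN : (mdeg m < N)%N by [].
rewrite !(fps_mul_trunc _ _ mN).
rewrite (eq_mcoeffM mN (p' := fps_trunc N f)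
  (q' := fps_trunc N g * fps_trunc N h)) //; last first.
  by move=> k kN; rewrite fps_trunc_mul.
rewrite mulrA; apply: (eq_mcoeffM mN) => // k kN; by rewrite fps_trunc_mul.
Qed.

Fact fps_mulC : commutative fps_mul.
Proof.
move=> f g; apply: fpserP => m.
by rewrite !(fps_mul_trunc _ _ (ltnSn (mdeg m))) mulrC.
Qed.

Fact fps_mul1 : left_id fps_one fps_mul.
Proof.
move=> f; apply: fpserP => m; have mN := ltnSn (mdeg m).
rewrite (fps_mul_trunc _ _ mN).
rewrite (eq_mcoeffM mN (p' := 1) (q' := fps_trunc (mdeg m).+1 f)) //.
  by rewrite mul1r mcoeff_trunc.
by move=> k kN; rewrite mcoeff_trunc // mcoeff1.
Qed.

Fact fps_mulDl : left_distributive fps_mul fps_add.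
Proof.
move=> f g h; apply: fpserP => m /=; rewrite -big_split /=.
by apply: eq_bigr => k _; rewrite mulrDl.
Qed.

Fact fps_1neq0 : fps_one != 0.
Proof.
apply/eqP => /(congr1 (fun f : fpser n K => f 0%MM)) /=.
by rewrite eqxx; apply/eqP/oner_neq0.
Qed.

HB.instance Definition _ := GRing.Zmodule_isComNzRing.Build (fpser n K)
  fps_mulA fps_mulC fps_mul1 fps_mulDl fps_1neq0.

End FormalPowerSeries.

(* Absolute convergence on a polydisc of positive radius, i.e. bounded
   partial sums. *)
Definition convergent (n : nat) (K : fieldType) (R : realType)
    (abs : absvalue K R) (f : fpser n K) : Prop :=
  exists2 r : R, 0 < r & exists M : R, forall N : nat,
    \sum_(m : 'X_{1..n < N}) abs (f m) * r ^+ mdeg m <= M.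

Section ConvergentPowerSeries.
Variables (n : nat) (K : fieldType) (R : realType) (abs : absvalue K R).
Implicit Types f g : fpser n K.

Lemma absv0 : abs 0 = 0.
Proof. exact/absv_eq0. Qed.

Lemma absv1 : abs 1 = 1.
Proof.
have nz : abs 1 != 0.
  by apply/eqP => /absv_eq0 /eqP; rewrite oner_eq0.
by apply: (mulfI nz); rewrite -absvM !mulr1.
Qed.

Lemma absvN x : abs (- x) = abs x.
Proof.
suff h : abs (-1) = 1 by rewrite -mulN1r absvM h mul1r.
have /eqP : abs (-1) ^+ 2 = 1 by rewrite expr2 -absvM mulrNN mulr1 absv1.
rewrite sqrf_eq1 => /orP[/eqP //|/eqP h].
by have := absv_ge0 abs (-1); rewrite h oppr_ge0 ler10.
Qed.

Lemma absv_sum (I : Type) (s : seq I) (P : pred I) (F : I -> K) :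
  abs (\sum_(i <- s | P i) F i) <= \sum_(i <- s | P i) abs (F i).
Proof.
elim/big_rec2: _ => [|i y x _ h]; first by rewrite absv0.
by apply: le_trans (absv_triangle _ _ _) _; rewrite lerD2l.
Qed.

Definition convergent_pred : {pred fpser n K} :=
  [pred f | `[< convergent abs f >]].

Lemma convergent_common f g : convergent abs f -> convergent abs g ->
  exists2 r : R, 0 < r & exists M : R, forall N : nat,
    \sum_(m : 'X_{1..n < N}) abs (f m) * r ^+ mdeg m <= M /\
    \sum_(m : 'X_{1..n < N}) abs (g m) * r ^+ mdeg m <= M.
Proof.
move=> [r r0 [M hM]] [s s0 [L hL]].
have rs0 : 0 < Num.min r s by rewrite lt_min r0.
exists (Num.min r s) => //; exists (Num.max M L) => N; split.
  apply: le_trans (_ : M <= _); last by rewrite le_max lexx.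
  apply: le_trans (hM N); apply: ler_sum => m _.
  apply: ler_wpM2l; first exact: absv_ge0.
  by apply: lerXn2r; rewrite ?nnegrE ?ge_min ?lexx // ltW.
apply: le_trans (_ : L <= _); last by rewrite le_max lexx orbT.
apply: le_trans (hL N); apply: ler_sum => m _.
apply: ler_wpM2l; first exact: absv_ge0.
by apply: lerXn2r; rewrite ?nnegrE ?ge_min ?lexx ?orbT // ltW.
Qed.

Fact convergent1 : convergent abs (1 : fpser n K).
Proof.
exists 1 => //; exists 1 => N.
case: N => [|N].
  rewrite big1 // => -[m lem] _; by have := lem; rewrite ltn0.
have h0 : (mdeg (0%MM : 'X_{1..n}) < N.+1)%N by rewrite mdeg0.
rewrite (bigD1 (BMultinom h0)) //= eqxx absv1 expr1n mulr1 big1 ?addr0 //.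
move=> k; rewrite -val_eqE /= => /negPf ->; by rewrite absv0 mul0r.
Qed.

Fact convergentB f g :
  convergent abs f -> convergent abs g -> convergent abs (f - g).
Proof.
move=> cf cg; have [r r0 [M hM]] := convergent_common cf cg.
exists r => //; exists (M + M) => N; have [h1 h2] := hM N.
apply: le_trans (lerD h1 h2); rewrite -big_split /=.
apply: ler_sum => m _; rewrite -mulrDl ler_wpM2r ?exprn_ge0 ?(ltW r0) //.
by apply: le_trans (absv_triangle _ _ _) _; rewrite absvN.
Qed.

Fact convergentM f g :
  convergent abs f -> convergent abs g -> convergent abs (f * g).
Proof.
move=> cf cg; have [r r0 [M hM]] := convergent_common cf cg.
exists r => //; exists (M * M) => N; have [h1 h2] := hM N.
pose F (h : fpser n K) (m : 'X_{1..n}) := abs (h m) * r ^+ mdeg m.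
have F0 h m : 0 <= F h m by rewrite mulr_ge0 ?absv_ge0 ?exprn_ge0 ?(ltW r0).
have S0 h : 0 <= \sum_(m : 'X_{1..n < N}) F h m by apply: sumr_ge0.
apply: le_trans (ler_pM (S0 f) (S0 g) h1 h2).
rewrite big_distrlr /= pair_bigA /=.
apply: le_trans (_ : \sum_(m : 'X_{1..n < N})
  \sum_(k : 'X_{1..n < N, N} | bmnm m == (k.1 + k.2)%MM)
     F f k.1 * F g k.2 <= _).
  apply: ler_sum => m _.
  have e : abs ((f * g) m) <= \sum_(k : 'X_{1..n < N, N} |
      bmnm m == (k.1 + k.2)%MM) abs (f k.1 * g k.2).
    by apply: le_trans (absv_sum _ _ _); rewrite -(fps_mulE f g (bmdeg m)).
  apply: le_trans (ler_wpM2r (exprn_ge0 (mdeg m) (ltW r0)) e) _.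
  rewrite mulr_suml le_eqVlt; apply/orP; left; apply/eqP.
  apply: eq_bigr => k /eqP ->.
  by rewrite /F mdegD exprD absvM mulrACA.
rewrite (exchange_big_dep predT) //=; apply: ler_sum => k _.
case: (pickP (fun m : 'X_{1..n < N} => bmnm m == (k.1 + k.2)%MM)) => [m0 h|h].
  rewrite (bigD1 m0) //= big1 ?addr0 // => m /andP[/eqP e].
  by rewrite -val_eqE /= e (eqP h) eqxx.
by rewrite big_pred0 // mulr_ge0.
Qed.

Fact convergent_subring : subring_closed convergent_pred.
Proof.
split=> [|f g /asboolP cf /asboolP cg|f g /asboolP cf /asboolP cg].
- exact/asboolP/convergent1.
- exact/asboolP/convergentB.
- exact/asboolP/convergentM.
Qed.

HB.instance Definition _ :=
  GRing.isSubringClosed.Build (fpser n K) convergent_pred convergent_subring.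

Record cpser := CPSer {
  cps_val :> fpser n K;
  _ : cps_val \in convergent_pred
}.

HB.instance Definition _ := [isSub for cps_val].
HB.instance Definition _ := [Choice of cpser by <:].
HB.instance Definition _ := [SubChoice_isSubComNzRing of cpser by <:].

End ConvergentPowerSeries.

Arguments cpser n {K R} abs.

Definition ideal2 (A : comNzRingType) (f g : A) : set A :=
  [set h | exists u v : A, h = u * f + v * g]%classic.

Definition radical (A : comNzRingType) (I : set A) : set A :=
  [set h | exists q : nat, I (h ^+ q)]%classic.

(* Meant for an ideal P of height 2, as is that of a space curve germ. *)
Definition set_theoretic_ci (A : comNzRingType) (P : set A) : Prop :=
  exists f g : A, P = radical (ideal2 f g).

(* The series f(phi_1(t), ..., phi_n(t)) in K[[t]].  Only monomials of
   degree at most d contribute to the coefficient of t^d provided that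
   every phi_i vanishes at 0, so this is meaningful for such phi only. *)
Definition fps_subst (n : nat) (K : fieldType) (phi : 'I_n -> {poly K})
    (f : fpser n K) : fpser 1 K :=
  FPSer (fun d : 'X_{1..1} =>
    \sum_(m : 'X_{1..n < (mdeg d).+1})
       f m * (\prod_(i < n) phi i ^+ m i)`_(mdeg d)).

(* The kernel of K{x,y,z} -> K{t}, (x,y,z) |-> (xi,eta,zeta), i.e. the ideal
   of the germ with ring K{xi,eta,zeta}; vanishing is tested in K[[t]],
   which contains K{t}. *)
Definition space_curve_ideal (K : fieldType) (R : realType)
    (abs : absvalue K R) (xi eta zeta : {poly K}) : set (cpser 3 abs) :=
  [set f : cpser 3 abs |
     fps_subst (tnth [tuple xi; eta; zeta]) f = 0]%classic.

Arguments space_curve_ideal {K R} abs xi eta zeta.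

Definition semigroup3 (l m n : nat) : set nat :=
  [set x | exists i j k : nat, x = (i * l + j * m + k * n)%N]%classic.

Definition is_conductor (G : set nat) (gamma : nat) : Prop :=
  (forall x, (gamma <= x)%N -> G x) /\
  (forall gamma', (forall x, (gamma' <= x)%N -> G x) -> (gamma <= gamma')%N).

Definition minimal_multiple (a l m n : nat) : Prop :=
  [/\ (0 < a)%N,
      exists u v : nat, (a * l = u * m + v * n)%N
    & forall a', (0 < a')%N ->
        (exists u v : nat, (a' * l = u * m + v * n)%N) -> (a <= a')%N].

Record herzog_H1 (l m n a b c a1 a2 b1 b2 c1 c2 : nat) : Prop := HerzogH1 {
  H1_a_min : minimal_multiple a l m n;
  H1_b_min : minimal_multiple b m l n;
  H1_c_min : minimal_multiple c n l m;
  H1_a_rel : (a * l = b1 * m + c2 * n)%N;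
  H1_b_rel : (b * m = a2 * l + c1 * n)%N;
  H1_c_rel : (c * n = a1 * l + b2 * m)%N;
  H1_a_pos : (0 < a1)%N /\ (0 < a2)%N;
  H1_b_pos : (0 < b1)%N /\ (0 < b2)%N;
  H1_c_pos : (0 < c1)%N /\ (0 < c2)%N
}.

(* None stands for infinity. *)
Definition enat := option nat.

Definition enat_le (x y : enat) : bool :=
  match x, y with
  | _, None => true
  | None, Some _ => false
  | Some i, Some j => (i <= j)%N
  end.

Definition enat_min (x y : enat) : enat := if enat_le x y then x else y.

Definition enat_addl (k : nat) (x : enat) : enat := omap (addn k) x.

(* K[t,s] is {poly {poly K}}, with t the outer and s the inner variable. *)
Definition monomial_deformation (K : fieldType) (l : nat) (D : enat)
    (p : {poly {poly K}}) : Prop :=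
  exists (N : nat) (c : nat -> K),
    p = 'X^l +
        \sum_(i < N | enat_le (enat_addl l D) (Some (nat_of_ord i)))
           (c i *: 'X^(i - l)) *: 'X^i.

Definition at_s1 (K : fieldType) (p : {poly {poly K}}) : {poly K} :=
  map_poly (horner_eval 1) p.

(* Main.v *)
Require Import Defs.
From mathcomp Require Import all_boot all_order all_algebra.
From mathcomp Require Import boolp classical_sets reals mpoly.
From mathcomp Require Import zify ring lra.

(** Let f1, f2, f3 be the three Herzog binomials.  Put X = x^a1, Y = y^b1, and
    consider the 2x2 minors
      F1 = X e - Y z^c2,   F2 = Y v - z^c1 e,   F3 = X v - z^c
    of the matrix with rows (X, Y, z^c1) and (z^c2, e, v).  For e = x^a2 and
    v = y^b2 they are f1, f2, f3.  The point of the proof is that the curve C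
    is defined by such minors with e = x^a2 - h1 and v = y^b2 - h3, where h1 and
    h3 are convergent series of higher weight, and that determinantal curves of
    this shape are set-theoretic complete intersections.

    The curve lies on the minors.  Since xi, eta, zeta agree with
    t^l, t^m, t^n up to relative order delta, the values of f1 and f3 on C have
    order at least d1 + delta and d3 + delta, hence at least gamma + a1 l,
    because k l >= a1 l.  By the definition of the conductor every exponent
    from gamma on is the weight of a monomial, and so such values have the form
    x^a1 h(x,y,z) on C ([representation]).  This corrects f1 and f3 to F1 and F3
    vanishing on C; then F2 vanishes as well, by X F2 = Y F3 - z^c1 F1.

    The minors generate the ideal of C ([curve_ideal_gens]).  Modulo F1, F2, F3
    every convergent series is a combination of monomials x^p y^i z^j with
    y^i z^j outside (y^b, z^c, y^b1 z^c2).  By the minimality of a, b, c these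
    monomials have pairwise distinct weights ([standard_weight_inj]), so that no
    nonzero combination of them vanishes on C.

    Bresinsky's argument ([determinantal_stci]).  Expanding F1^c and replacing
    z^c by X v modulo F3 one finds F1^c = X^c2 G modulo F3, where G is
    (- Y)^c v^c2 modulo (X, z).  Then C is the common zero set of G and F3:
    on it F1 vanishes, hence so does X F2, and at points where X is zero so are
    z and Y v, hence F2.

    Both analytic steps rest on one division theorem for convergent power
    series ([division]), with weights for which the lead of each divisor is
    strictly lighter than its tail.  The reduction then determines quotients and
    remainder coefficient by coefficient, and it converges because a rewriting
    step contracts norms on small polydiscs. *)

Set Implicit Arguments.
Unset Strict Implicit.
Unset Printing Implicit Defensive.

Import Order.TTheory GRing.Theory Num.Theory.

(** * Formal power series and weighted orders *)

Section FpsBasics.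
Local Open Scope ring_scope.
Variables (n : nat) (K : comNzRingType).
Implicit Types (f g : fpser n K) (m mu : 'X_{1..n}).

Lemma fpsD f g m : (f + g) m = f m + g m. Proof. by []. Qed.
Lemma fpsN f m : (- f) m = - f m. Proof. by []. Qed.
Lemma fps0 m : (0 : fpser n K) m = 0. Proof. by []. Qed.

Lemma fps_sumE (I : Type) (s : seq I) (P : pred I) (F : I -> fpser n K) m :
  (\sum_(i <- s | P i) F i) m = \sum_(i <- s | P i) F i m.
Proof. by elim/big_rec2: _ => // i y x _ <-. Qed.

Lemma fpsM f g m : (f * g) m =
  \sum_(k : 'X_{1..n < (mdeg m).+1, (mdeg m).+1} | m == (k.1 + k.2)%MM)
     f k.1 * g k.2.
Proof. by []. Qed.

Lemma fpsM_neq0 f g m : (f * g) m != 0 ->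
  exists m1 m2, [/\ m = (m1 + m2)%MM, f m1 != 0 & g m2 != 0].
Proof.
rewrite fpsM => h; apply: contrapT => no; case/eqP: h.
rewrite big1 // => -[k1 k2] /= /eqP Em; apply/eqP; rewrite -[_ == 0]negbK.
apply/negP => fg0; apply: no; exists k1, k2; split=> //.
  by apply: contra fg0 => /eqP ->; rewrite mul0r.
by apply: contra fg0 => /eqP ->; rewrite mulr0.
Qed.

Definition fps_of_mpoly (p : {mpoly K[n]}) : fpser n K :=
  FPSer (fun m => p@_m).

Lemma fps_of_mpolyB p q :
  fps_of_mpoly (p - q) = fps_of_mpoly p - fps_of_mpoly q.
Proof. by apply: fpserP => m /=; rewrite mcoeffB. Qed.

Lemma fps_of_mpolyM p q :
  fps_of_mpoly (p * q) = fps_of_mpoly p * fps_of_mpoly q.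
Proof. by apply: fpserP => m; rewrite fpsM /= mcoeffM. Qed.

Lemma fps_of_mpoly1 : fps_of_mpoly 1 = 1.
Proof. by apply: fpserP => m; rewrite /= mcoeff1. Qed.

Lemma fps_of_mpolyX p k : fps_of_mpoly (p ^+ k) = fps_of_mpoly p ^+ k.
Proof.
by elim: k => [|k IH]; rewrite ?fps_of_mpoly1 // !exprS fps_of_mpolyM IH.
Qed.

Definition fps_mono mu := fps_of_mpoly 'X_[mu].

Lemma fps_monoE mu m : fps_mono mu m = (mu == m)%:R.
Proof. by rewrite /= mcoeffX. Qed.

Lemma fps_monoD mu nu : fps_mono (mu + nu)%MM = fps_mono mu * fps_mono nu.
Proof. by rewrite /fps_mono mpolyXD fps_of_mpolyM. Qed.

Lemma fps_mulmono f mu k : (f * fps_mono mu) (k + mu)%MM = f k.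
Proof.
rewrite -[LHS]/(fps_mul f (fps_mono mu) (k + mu)%MM).
have N := ltnSn (mdeg (k + mu)); rewrite (fps_mul_trunc _ _ N).
rewrite (eq_mcoeffM N (p' := fps_trunc (mdeg (k + mu)).+1 f)
  (q' := 'X_[mu])) //.
  rewrite [(k + mu)%MM]addmC mcoeffMX mcoeff_trunc // ltnS mdegD leq_addl //.
by move=> i Hi; rewrite mcoeff_trunc.
Qed.

Lemma fps_mulmono0 f mu m : ~~ (mu <= m)%MM -> (f * fps_mono mu) m = 0.
Proof.
move=> h; apply/eqP; apply: contraNT h => /fpsM_neq0 [m1 [m2 [-> _]]].
by rewrite fps_monoE; case: (mu =P m2) => [-> _|_]; rewrite ?eqxx // lem_addl.
Qed.

Definition wt (w : 'I_n -> nat) m := (\sum_i w i * m i)%N.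

Definition wt_ge w d f := forall m, (wt w m < d)%N -> f m = 0.

Lemma wtD w m1 m2 : wt w (m1 + m2) = (wt w m1 + wt w m2)%N.
Proof.
by rewrite /wt -big_split; apply: eq_bigr => i _; rewrite mnmDE mulnDr.
Qed.

Lemma mdeg_le_wt w m : (forall i, 0 < w i)%N -> (mdeg m <= wt w m)%N.
Proof.
by move=> w0; rewrite mdegE; apply: leq_sum => i _; rewrite leq_pmull.
Qed.

Lemma wt_geP w d f m : wt_ge w d f -> f m != 0 -> (d <= wt w m)%N.
Proof. by move=> H; apply: contraR; rewrite -ltnNge => /H ->. Qed.

Lemma wt_ge_leq w d d' f : (d' <= d)%N -> wt_ge w d f -> wt_ge w d' f.
Proof. by move=> h H m mw; apply: H; apply: leq_trans h. Qed.

Lemma wt_geD w d f g : wt_ge w d f -> wt_ge w d g -> wt_ge w d (f + g).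
Proof. by move=> F G m mw; rewrite fpsD F ?G ?addr0. Qed.

Lemma wt_geN w d f : wt_ge w d f -> wt_ge w d (- f).
Proof. by move=> F m mw; rewrite fpsN F ?oppr0. Qed.

Lemma wt_geM w d e f g : wt_ge w d f -> wt_ge w e g -> wt_ge w (d + e) (f * g).
Proof.
move=> F G m; apply: contraTeq => /fpsM_neq0 [m1 [m2 [-> h1 h2]]].
by rewrite -leqNgt wtD leq_add ?(wt_geP F) ?(wt_geP G).
Qed.

Lemma wt_ge_mono w mu : wt_ge w (wt w mu) (fps_mono mu).
Proof. by move=> m; rewrite fps_monoE; case: eqP => // ->; rewrite ltnn. Qed.

End FpsBasics.

Section Convergence.
Local Open Scope ring_scope.
Variables (n : nat) (K : fieldType) (R : realType) (abs : absvalue K R).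
Implicit Types (f g : fpser n K) (m mu : 'X_{1..n}).

Lemma sum_half_exp N : \sum_(j < N) (2^-1 : R) ^+ j <= 2.
Proof.
suff -> : \sum_(j < N) (2^-1 : R) ^+ j = 2 - 2 * 2^-1 ^+ N.
  by rewrite gerBl mulr_ge0 // exprn_ge0 // invr_ge0.
elim: N => [|N IH]; first by rewrite big_ord0 expr0 mulr1 subrr.
by rewrite big_ord_recr /= IH exprS; field.
Qed.

(** The sum is part of the product over the variables of a geometric
    series. *)
Lemma sum_half_mdeg N :
  \sum_(m : 'X_{1..n < N}) (2^-1 : R) ^+ mdeg m <= 2 ^+ n.
Proof.
pose G (F : {ffun 'I_n -> 'I_N}) : R := \prod_i 2^-1 ^+ F i.
apply: (@le_trans _ _ (\sum_F G F)); last first.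
  rewrite -(bigA_distr_bigA (fun _ (j : 'I_N) => (2^-1 : R) ^+ j)).
  rewrite -[in leRHS](card_ord n) -prodr_const.
  apply: ler_prod => i _; rewrite sum_half_exp andbT.
  by apply: sumr_ge0 => j _; rewrite exprn_ge0 // invr_ge0.
have bnd (m : 'X_{1..n < N}) i : (m i < N)%N.
  by apply: leq_ltn_trans (bmdeg m); rewrite mdegE (bigD1 i) //= leq_addr.
pose H (m : 'X_{1..n < N}) : {ffun 'I_n -> 'I_N} :=
  [ffun i => Ordinal (bnd m i)].
have Hinj : injective H.
  move=> m1 m2 /ffunP E; apply/val_inj/mnmP => i.
  by have := congr1 val (E i); rewrite !ffunE.
have -> : \sum_(m : 'X_{1..n < N}) (2^-1 : R) ^+ mdeg m
  = \sum_(m : 'X_{1..n < N}) G (H m).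
  apply: eq_bigr => m _; rewrite mdegE -prodrXr.
  by apply: eq_bigr => i _; rewrite ffunE.
rewrite -(big_image _ _ H predT G) /=.
rewrite (perm_big (enum (codom H))); last first.
  apply: uniq_perm; [by rewrite map_inj_uniq ?enum_uniq|exact: enum_uniq|].
  by move=> F; rewrite mem_enum.
rewrite big_enum /= [leRHS](bigID [pred F in codom H]) /= lerDl.
by apply: sumr_ge0 => F _; apply: prodr_ge0 => i _;
  rewrite exprn_ge0 // invr_ge0.
Qed.

(** Convergence as a growth condition on single coefficients (Cauchy
    estimates). In this form it is stable under shifting the exponents or
    discarding terms, and it is what a recursion on coefficients can
    deliver. *)
Lemma convergentP f : convergent abs f <->
  exists C L : R, 0 < L /\ forall m, abs (f m) <= C * L ^+ mdeg m.
Proof.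
split=> [[r r0 [M hM]]|[C [L [L0 h]]]].
  exists M, r^-1; split=> [|m]; first by rewrite invr_gt0.
  rewrite exprVn ler_pdivlMr ?exprn_gt0 //; apply: le_trans (hM (mdeg m).+1).
  rewrite (bigD1 (BMultinom (ltnSn (mdeg m)))) //= lerDl;
    apply: sumr_ge0 => k _.
  by rewrite mulr_ge0 ?absv_ge0 ?exprn_ge0 ?(ltW r0).
exists (2 * L)^-1; first by rewrite invr_gt0 mulr_gt0.
exists (C * 2 ^+ n) => N.
have C0 : 0 <= C by apply: le_trans (absv_ge0 abs (f 0%MM)) _; have := h 0%MM;
  rewrite mdeg0 mulr1.
apply: le_trans (ler_wpM2l C0 (sum_half_mdeg N)); rewrite mulr_sumr.
apply: ler_sum => m _.
have L0n : 0 < L ^+ mdeg m by rewrite exprn_gt0.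
rewrite invfM exprMn [_^-1 ^+ _ * _]mulrC mulrA; apply: ler_wpM2r.
  by rewrite exprn_ge0 ?invr_ge0.
by rewrite exprVn ler_pdivrMr //.
Qed.

Lemma convergent_mpoly (p : {mpoly K[n]}) : convergent abs (fps_of_mpoly p).
Proof.
apply/convergentP; exists (\sum_(m <- msupp p) abs p@_m), 1; split=> // m.
rewrite expr1n mulr1 /=; case: (boolP (m \in msupp p)) => hm; last first.
  by rewrite (memN_msupp_eq0 hm) absv0 sumr_ge0 // => i _; rewrite absv_ge0.
by rewrite (bigD1_seq m) //= lerDl sumr_ge0 // => i _; rewrite absv_ge0.
Qed.

Lemma convergentD f g :
  convergent abs f -> convergent abs g -> convergent abs (f + g).
Proof.
move=> cf cg; rewrite -[g]opprK; apply: convergentB => //.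
by rewrite -[- g]sub0r; apply: convergentB => //; rewrite -(subrr g);
  apply: convergentB.
Qed.

Lemma convergent_shift (k : 'X_{1..n}) f :
  convergent abs f -> convergent abs (FPSer (fun m => f (m + k)%MM)).
Proof.
move=> /convergentP[C [L [L0 h]]]; apply/convergentP.
exists (C * L ^+ mdeg k), L; split=> // m /=; apply: le_trans (h _) _.
by rewrite mdegD exprD -mulrA [_ * L ^+ mdeg k]mulrC.
Qed.

End Convergence.

(** * Division with remainder for convergent power series *)

Section Division.
Local Open Scope ring_scope.
Variables (n : nat) (K : fieldType) (w : 'I_n -> nat) (J : finType).
Variables (mu : J -> 'X_{1..n}) (g : J -> fpser n K).
Variable sel : 'X_{1..n} -> option J.
Hypothesis w_gt0 : forall i, (0 < w i)%N.
Hypothesis sel_le : forall m j, sel m = Some j -> (mu j <= m)%MM.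
Hypothesis g_wt : forall j, wt_ge w (wt w (mu j)).+1 (g j).
Implicit Types (f u : fpser n K) (m : 'X_{1..n}).

(** A term X^m with selected divisor j stands for X^(m - mu j) times the
    lead X^(mu j): these are the coefficients of the cofactors. *)
Definition quot u j : fpser n K :=
  FPSer (fun m => if sel (m + mu j)%MM == Some j then u (m + mu j)%MM else 0).

Definition normal_part u : fpser n K :=
  FPSer (fun m => if sel m is None then u m else 0).

(** One round of the reduction: every reducible term of u has its lead
    X^(mu j) replaced by the tail g j. A fixed point u lists all terms that
    ever occur while f is being reduced. *)
Definition rewrite_step f u : fpser n K := f + \sum_j quot u j * g j.

(** Tails are heavier than their leads, so a coefficient of the result only
    depends on coefficients of u of smaller weight. *)
Lemma rewrite_step_local f u u' d :
  (forall m, (wt w m < d)%N -> u m = u' m) ->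
  forall m, (wt w m < d.+1)%N -> rewrite_step f u m = rewrite_step f u' m.
Proof.
move=> uu' m md; rewrite !fpsD !fps_sumE; congr (_ + _).
apply: eq_bigr => j _; rewrite !fpsM; apply: eq_bigr => -[k1 k2] /= /eqP Em.
have [->|gk] := eqVneq (g j k2) 0; first by rewrite !mulr0.
congr (_ * _); case: ifP => // _; apply: uu'.
have := wt_geP (@g_wt j) gk; have := congr1 (wt w) Em; rewrite !wtD; lia.
Qed.

(** A coefficient of weight d is stationary after d + 1 rounds. *)
Definition reduct f : fpser n K :=
  FPSer (fun m => iter (wt w m).+1 (rewrite_step f) 0 m).

Lemma iter_stable f N N' m : (wt w m < N)%N -> (wt w m < N')%N ->
  iter N (rewrite_step f) 0 m = iter N' (rewrite_step f) 0 m.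
Proof.
elim: N N' m => // N IH [|N'] m //= mN mN';
  apply: (@rewrite_step_local f _ _ (minn N N')).
  by move=> k; rewrite leq_min => /andP[]; exact: IH.
by rewrite ltnS leq_min; apply/andP.
Qed.

Lemma reduct_fix f : reduct f = rewrite_step f (reduct f).
Proof.
apply: fpserP => m.
rewrite -[LHS]/(rewrite_step f (iter (wt w m) (rewrite_step f) 0) m).
apply: (@rewrite_step_local f _ _ (wt w m)) => // k km.
exact: (@iter_stable f (wt w m) (wt w k).+1).
Qed.

Lemma split_quot u :
  u = \sum_j quot u j * fps_mono K (mu j) + normal_part u.
Proof.
apply: fpserP => m; rewrite fpsD fps_sumE /=.
have E j :
  (quot u j * fps_mono K (mu j)) m = if sel m == Some j then u m else 0.
  case: (boolP (mu j <= m)%MM) => h.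
    by rewrite -(submK h) fps_mulmono /= submK.
  by rewrite fps_mulmono0 //; case: eqP => // /sel_le; rewrite (negPf h).
rewrite (eq_bigr _ (fun j _ => E j)) -big_mkcond /=.
case: (sel m) => [j|]; last by rewrite big_pred0 ?add0r.
by rewrite addr0 (big_pred1 j) // => i; apply/eqP/eqP => [[]|->].
Qed.

(** In the fixed point equation u = f + sum of (quot u j) * (g j), split u
    into its reducible and its irreducible terms. *)
Lemma division_eq f :
  f = \sum_j quot (reduct f) j * (fps_mono K (mu j) - g j)
      + normal_part (reduct f).
Proof.
apply: (@addIr _ (\sum_j quot (reduct f) j * g j)).
rewrite -[LHS]/(rewrite_step f (reduct f)) -reduct_fix {1}[reduct f]split_quot.
rewrite addrAC; congr (_ + _); rewrite -big_split /=.
by apply: eq_bigr => j _; rewrite mulrBr subrK.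
Qed.

(** A property of exponents that rewriting preserves holds for all terms
    that occur in a reduction. *)
Lemma reduct_supp (S : 'X_{1..n} -> Prop) f :
  (forall m, f m != 0 -> S m) ->
  (forall m j k, S m -> sel m = Some j -> g j k != 0 -> S (m - mu j + k)%MM) ->
  forall m, reduct f m != 0 -> S m.
Proof.
move=> Sf Sg m; have [d] := ubnP (wt w m); elim: d m => // d IH m md.
rewrite reduct_fix fpsD fps_sumE.
have [E0|//] := eqVneq (f m) 0; last by move=> /Sf.
rewrite E0 add0r => h; apply: contrapT => nS; case/eqP: h;
  rewrite big1 // => j _.
apply/eqP; apply: contrapT => /negP /fpsM_neq0 [k1 [k2 [Em]]] /=.
case: (sel _ =P Some j) => [s u0 g0|_]; last by rewrite eqxx.
apply: nS; rewrite Em -(addmK (mu j) k1); apply: (Sg _ _ _ _ s g0);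
  apply: IH u0.
have := wt_geP (@g_wt j) g0; move: md; rewrite Em !wtD; lia.
Qed.

Variables (R : realType) (abs : absvalue K R).

Lemma small_all (I : finType) (P : I -> R -> Prop) :
  (forall i, exists2 r0, 0 < r0 & forall r, 0 < r -> r <= r0 -> P i r) ->
  exists2 r0, 0 < r0 & forall r, 0 < r -> r <= r0 -> forall i, P i r.
Proof.
move=> H.
suff [r0 r00 h] : exists2 r0, 0 < r0 &
    forall r, 0 < r -> r <= r0 -> forall i, i \in enum I -> P i r.
  by exists r0 => // r r1 r2 i; apply: h; rewrite ?mem_enum.
elim: (enum I) => [|i s [r0 r00 IH]]; first by exists 1.
have [r1 r10 h] := H i; exists (Num.min r0 r1); first by rewrite lt_min r00.
move=> r rgt0; rewrite le_min => /andP[l0 l1] k.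
by rewrite inE => /orP[/eqP->|/IH]; [exact: h|exact].
Qed.

(** On the polydisc of weighted radius r, a series whose terms all have
    weight greater than d has norm O(r^(d+1)), hence o(r^d). *)
Lemma convergent_wt_small f d (eps : R) :
  convergent abs f -> wt_ge w d.+1 f -> 0 < eps ->
  exists2 r0, 0 < r0 & forall r, 0 < r -> r <= r0 -> forall N,
    \sum_(m : 'X_{1..n < N}) abs (f m) * r ^+ wt w m <= eps * r ^+ d.
Proof.
move=> [r1 r10 [M hM]] fw e0.
have M0 : 0 <= M by apply: le_trans (hM 0%N); apply: sumr_ge0 => m _;
  rewrite mulr_ge0 ?absv_ge0 ?exprn_ge0 ?(ltW r10).
pose s := Num.min r1 1; have s0 : 0 < s by rewrite lt_min r10 ltr01.
have s1 : s <= 1 by rewrite ge_min lexx orbT.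
have M1 : 0 < M + 1 by rewrite ltr_wpDl.
have sd0 : 0 < s ^+ d.+1 by rewrite exprn_gt0.
exists (Num.min s (eps * s ^+ d.+1 / (M + 1))).
  by rewrite lt_min s0 divr_gt0 // mulr_gt0.
move=> r rgt0; rewrite le_min => /andP[rs]; rewrite ler_pdivlMr // => rM N.
have q0 : 0 <= r / s by rewrite divr_ge0 ?ltW.
have q1 : r / s <= 1 by rewrite ler_pdivrMr // mul1r.
apply: (@le_trans _ _ ((r / s) ^+ d.+1 * M)); last first.
  rewrite expr_div_n mulrAC ler_pdivrMr // [in leLHS]exprSr.
  rewrite -mulrA mulrAC [leRHS]mulrC ler_wpM2l ?exprn_ge0 ?(ltW rgt0) //.
  by apply: le_trans rM; rewrite mulrDr mulr1 lerDl ltW.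
apply: le_trans (ler_wpM2l (exprn_ge0 _ q0) (hM N)).
rewrite mulr_sumr; apply: ler_sum => m _.
have [->|fm] := eqVneq (f m) 0; first by rewrite absv0 !mul0r mulr0.
rewrite mulrCA; apply: ler_wpM2l; first exact: absv_ge0.
have -> : r ^+ wt w m = (r / s) ^+ wt w m * s ^+ wt w m.
  by rewrite -exprMn divfK // gt_eqF.
apply: ler_pM; rewrite ?exprn_ge0 ?(ltW s0) //.
  by apply: ler_wiXn2l => //; exact: wt_geP fm.
apply: (@le_trans _ _ (s ^+ mdeg m)).
  by apply: ler_wiXn2l; rewrite ?(ltW s0) // mdeg_le_wt.
by apply: lerXn2r; rewrite ?nnegrE ?(ltW s0) ?(ltW r10) // ge_min lexx.
Qed.

Lemma convergent_wt_bounded f : convergent abs f ->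
  exists2 r0, 0 < r0 & exists C : R, forall r, 0 < r -> r <= r0 -> forall m,
    abs (f m) * r ^+ wt w m <= C.
Proof.
move=> /convergentP[C [L [L0 h]]].
exists (Num.min L^-1 1); first by rewrite lt_min invr_gt0 L0 ltr01.
exists C => r r0; rewrite le_min => /andP[rL r1] m.
apply: le_trans (ler_wpM2r _ (h m)) _; first by rewrite exprn_ge0 ?ltW.
have C0 : 0 <= C by apply: le_trans (absv_ge0 abs (f 0%MM)) _; have := h 0%MM;
  rewrite mdeg0 mulr1.
rewrite -mulrA ler_piMr //; apply: (@le_trans _ _ (L ^+ mdeg m * r ^+ mdeg m)).
  apply: ler_wpM2l; first by rewrite exprn_ge0 ?ltW.
  by apply: ler_wiXn2l; rewrite ?(ltW r0) // mdeg_le_wt.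
rewrite -exprMn; apply: exprn_ile1; first by rewrite mulr_ge0 ?ltW.
by rewrite -ler_pdivlMl // mulr1.
Qed.

Lemma wt_bounded_convergent f (C r : R) : 0 < r -> r <= 1 ->
  (forall m, abs (f m) * r ^+ wt w m <= C) -> convergent abs f.
Proof.
move=> r0 r1 h; pose W := (\sum_i w i)%N.
have wW m : (wt w m <= W * mdeg m)%N.
  rewrite /W mulnC /wt big_distrr /=; apply: leq_sum => i _; rewrite mulnC.
  by rewrite leq_mul2r mdegE [X in (_ <= X)%N](bigD1 i) //= leq_addr orbT.
apply/convergentP; exists C, (r ^+ W)^-1; split=> [|m].
  by rewrite invr_gt0 exprn_gt0.
rewrite exprVn ler_pdivlMr ?exprn_gt0 //; apply: le_trans (h m).
apply: ler_wpM2l; first exact: absv_ge0.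
by rewrite -exprM; apply: ler_wiXn2l; rewrite ?(ltW r0).
Qed.

(** On a small weighted polydisc one rewriting round has norm at most 1/2,
    so the geometric series of all rounds at most doubles the bound for f.
    The sum is never formed: the estimate is proved for the coefficients of
    the fixed point by induction on the weight. *)
Lemma reduct_bound f (C r : R) : 0 < r ->
  (forall j N, \sum_(m : 'X_{1..n < N}) abs (g j m) * r ^+ wt w m
     <= (2 * #|J|.+1%:R)^-1 * r ^+ wt w (mu j)) ->
  (forall m, abs (f m) * r ^+ wt w m <= C) ->
  forall m, abs (reduct f m) * r ^+ wt w m <= 2 * C.
Proof.
move=> r0 hg hf m; have [d] := ubnP (wt w m); elim: d m => // d IH m md.
have rn0 k : 0 < r ^+ k by rewrite exprn_gt0.
have C0 : 0 <= C by apply: le_trans (hf 0%MM); rewrite mulr_ge0 ?absv_ge0 ?ltW.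
set eps := (_)^-1 in hg.
have eps0 : 0 <= eps by rewrite invr_ge0 mulr_ge0.
have step j : abs ((quot (reduct f) j * g j) m) * r ^+ wt w m <= 2 * C * eps.
  rewrite fpsM; apply: le_trans (ler_wpM2r (ltW (rn0 _)) (absv_sum _ _ _ _)) _.
  rewrite -(ler_pM2r (rn0 (wt w (mu j)))).
  apply: (@le_trans _ _ (2 * C * \sum_(k : 'X_{1..n < (mdeg m).+1})
                                   abs (g j k) * r ^+ wt w k)); last first.
    by rewrite -[X in _ <= X]mulrA; apply: ler_wpM2l;
      [rewrite mulr_ge0|exact: hg].
  rewrite -mulrA mulr_suml.
  apply: (@le_trans _ _ (\sum_(k : 'X_{1..n < (mdeg m).+1, (mdeg m).+1} |
       m == (k.1 + k.2)%MM) 2 * C * (abs (g j k.2) * r ^+ wt w k.2))).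
    apply: ler_sum => -[k1 k2] /= /eqP Em; rewrite absvM /=.
    have [->|gk] := eqVneq (g j k2) 0;
      first by rewrite absv0 mulr0 !mul0r mulr0.
    have Ew := congr1 (wt w) Em; rewrite wtD in Ew; rewrite Ew exprD.
    set A := abs _; set B := abs _; rewrite [leLHS](_ : _ =
      A * r ^+ wt w (k1 + mu j)%MM * (B * r ^+ wt w k2));
        last by rewrite wtD exprD; ring.
    apply: ler_wpM2r; first by rewrite mulr_ge0 ?absv_ge0 ?ltW.
    rewrite /A; case: ifP => _; last by rewrite absv0 mul0r mulr_ge0.
    by apply: IH; have := wt_geP (@g_wt j) gk; rewrite wtD; lia.
  rewrite -mulr_sumr; apply: ler_wpM2l; first by rewrite mulr_ge0.
  rewrite -(pair_big_dep predT (fun k1 k2 : 'X_{1..n < _} => m == (k1 + k2)%MM)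
     (fun _ k2 => abs (g j k2) * r ^+ wt w k2)) /=.
  rewrite (exchange_big_dep predT) //=; apply: ler_sum => k2 _.
  have G0 : 0 <= abs (g j k2) * r ^+ wt w k2 by rewrite mulr_ge0 ?absv_ge0 ?ltW.
  case: (pickP (fun k : 'X_{1..n < (mdeg m).+1} => m == (k + k2)%MM))
    => [k1 h|h]; last first.
    by rewrite big_pred0.
  rewrite (bigD1 k1) //= big1 ?addr0 // => k /andP[/eqP e];
    rewrite -val_eqE /= => /eqP[].
  by apply: (@addIm _ k2); exact: etrans (esym e) (eqP h).
rewrite reduct_fix fpsD fps_sumE.
apply: le_trans (ler_wpM2r (ltW (rn0 _)) (absv_triangle _ _ _)) _.
rewrite mulrDl.
apply: (@le_trans _ _ (C + \sum_(j : J) 2 * C * eps)).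
  apply: lerD => //;
    apply: le_trans (ler_wpM2r (ltW (rn0 _)) (absv_sum _ _ _ _)) _.
  by rewrite mulr_suml; apply: ler_sum.
rewrite sumr_const -[_ *+ #|_|]mulr_natr (_ : 2 * C = C + C); last by ring.
rewrite lerD2l -[X in _ <= X]mulr1 (_ : (C + C) * eps * _ = C *
  (2 * eps * #|J|%:R)); last by ring.
apply: ler_wpM2l => //; rewrite /eps (_ : 2 * _ * _ = #|J|%:R / #|J|.+1%:R);
  last first.
  by field; rewrite addrC natr1 pnatr_eq0.
by rewrite ler_pdivrMr ?ltr0n // mul1r ler_nat.
Qed.

Hypothesis g_conv : forall j, convergent abs (g j).

Lemma reduct_convergent f : convergent abs f -> convergent abs (reduct f).
Proof.
move=> /convergent_wt_bounded[r1 r10 [C hC]].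
have e0 : 0 < (2 * #|J|.+1%:R)^-1 :> R by rewrite invr_gt0 mulr_gt0 ?ltr0n.
have [r2 r20 hg] := small_all (fun j => convergent_wt_small (g_conv j)
  (@g_wt j) e0).
pose r := Num.min 1 (Num.min r1 r2).
have r0 : 0 < r by rewrite !lt_min ltr01 r10.
have r_1 : r <= 1 by rewrite ge_min lexx.
have r_r1 : r <= r1 by rewrite !ge_min lexx orbT.
have r_r2 : r <= r2 by rewrite !ge_min lexx !orbT.
apply: (wt_bounded_convergent r0 r_1 (C := 2 * C)).
by apply: reduct_bound => //; [exact: hg|exact: hC].
Qed.

(** Division in the ring of convergent power series by the elements X^(mu
    j) - g j whose tails g j are heavier than their leads, in the manner of
    Grauert and Hironaka. The function sel says which divisor reduces a
    given monomial; letting it differ from mere divisibility of monomials,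
    and keeping track of an invariant S of the exponents, is what makes the
    theorem applicable to the conductor of the curve as well. *)
Theorem division (S : 'X_{1..n} -> Prop) f :
  convergent abs f -> (forall m, f m != 0 -> S m) ->
  (forall m j k, S m -> sel m = Some j -> g j k != 0 -> S (m - mu j + k)%MM) ->
  exists (q : J -> fpser n K) (rem : fpser n K),
  [/\ forall j, convergent abs (q j), convergent abs rem,
      f = \sum_j q j * (fps_mono K (mu j) - g j) + rem &
      forall m, rem m != 0 -> S m /\ sel m = None].
Proof.
move=> cf Sf Sg; have cu := reduct_convergent cf.
have sub u (v : fpser n K) : convergent abs u ->
    (forall m, v m = u m \/ v m = 0) -> convergent abs v.
  move=> /convergentP[C [L [L0 h]]] uv; apply/convergentP; exists C, L;
    split=> // m.
  have := h m; case: (uv m) => -> // h'; rewrite absv0.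
  by apply: le_trans h'; exact: absv_ge0.
exists (quot (reduct f)), (normal_part (reduct f)); split.
- move=> j; apply: sub (convergent_shift (mu j) cu) _ => m /=.
  by case: ifP; [left|right].
- by apply: sub cu _ => m /=; case: (sel m); [right|left].
- exact: division_eq.
- move=> m /=; case E: (sel m) => [j|]; first by rewrite eqxx.
  by move=> um; split=> //; exact: reduct_supp um.
Qed.
End Division.

(** * Substituting polynomials in one variable *)

Section Evaluation.
Local Open Scope ring_scope.

(** The polynomials t^w + (terms of order at least w + D). The factored
    form makes stability under products immediate. *)
Definition near_mono (K : fieldType) (w D : nat) (p : {poly K}) :=
  exists q, p = 'X^w * (1 + 'X^D * q).

Lemma near_monoM (K : fieldType) (w w' D : nat) (p p' : {poly K}) :
  near_mono w D p -> near_mono w' D p' -> near_mono (w + w') D (p * p').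
Proof.
move=> [q ->] [q' ->]; exists (q + q' + 'X^D * q * q').
by rewrite exprD; ring.
Qed.

Lemma near_mono1 (K : fieldType) (D : nat) : near_mono 0 D (1 : {poly K}).
Proof. by exists 0; rewrite mulr0 addr0 mulr1. Qed.

Lemma near_monoX (K : fieldType) (w D k : nat) (p : {poly K}) :
  near_mono w D p -> near_mono (w * k) D (p ^+ k).
Proof.
move=> h; elim: k => [|k IH]; first by rewrite muln0; exact: near_mono1.
by rewrite mulnS exprS; exact: near_monoM.
Qed.

Lemma near_mono_coef (K : fieldType) (w D : nat) (p : {poly K}) i :
  near_mono w D p -> (i < w + D)%N -> p`_i = (i == w)%:R.
Proof.
move=> [q ->] iD; rewrite coefXnM; case: ltnP => iw; first by rewrite ltn_eqF.
rewrite coefD coef1 coefXnM ltn_subLR // iD addr0.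
by rewrite subn_eq0 eqn_leq iw andbT.
Qed.

Variables (n : nat) (K : fieldType) (phi : 'I_n -> {poly K}).
Variables (w : 'I_n -> nat) (D : nat).
Hypothesis w_gt0 : forall j, (0 < w j)%N.
Hypothesis D_gt0 : (0 < D)%N.
Hypothesis phiP : forall j, near_mono (w j) D (phi j).
Implicit Types (f g : fpser n K) (m : 'X_{1..n}) (p q : {mpoly K[n]}).

Definition msubst p : {poly K} := mmap (@polyC K) phi p.

Lemma msubstX m : msubst 'X_[m] = \prod_j phi j ^+ m j.
Proof. by rewrite /msubst mmapX. Qed.

Lemma msubstM p q : msubst (p * q) = msubst p * msubst q.
Proof. by rewrite /msubst rmorphM. Qed.

Lemma msubstB p q : msubst (p - q) = msubst p - msubst q.
Proof. by rewrite /msubst rmorphB. Qed.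

Lemma near_mono_msubstX m : near_mono (wt w m) D (msubst 'X_[m]).
Proof.
rewrite msubstX /wt; elim/big_ind2: _ => [|? ? ? ? ? ?|j _].
- exact: near_mono1.
- exact: near_monoM.
- exact: near_monoX.
Qed.

Lemma msubstX_coef m i :
  (i < wt w m + D)%N -> (msubst 'X_[m])`_i = (i == wt w m)%:R.
Proof. by apply: near_mono_coef; exact: near_mono_msubstX. Qed.

(** Every phi j vanishes at 0, so monomials of degree above i do not reach
    t^i. *)
Lemma msubst_agree p q i :
  (forall m, (mdeg m <= i)%N -> p@_m = q@_m) -> (msubst p)`_i = (msubst q)`_i.
Proof.
move=> h; apply/eqP; rewrite -subr_eq0 -coefB -msubstB [p - q]mpolyE.
rewrite /msubst raddf_sum coef_sum big1 // => m _ /=.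
rewrite mmapZ coefCM; case: (leqP (mdeg m) i) => mi.
  by rewrite mcoeffB h // subrr mul0r.
have iw := leq_trans mi (mdeg_le_wt m w_gt0).
by rewrite msubstX_coef ?ltn_addr // ltn_eqF // mulr0.
Qed.

(** The coefficient of t^i in f(phi), read off from a polynomial truncation
    of f so that the ring operations are inherited from polynomials. *)
Definition subst_coef f i : K := (msubst (fps_trunc i.+1 f))`_i.

Lemma subst_coefE N f i :
  (i < N)%N -> subst_coef f i = (msubst (fps_trunc N f))`_i.
Proof.
move=> iN; apply: msubst_agree => m mi; rewrite !mcoeff_trunc //.
exact: leq_ltn_trans iN.
Qed.

Lemma subst_coef_mpoly p i : subst_coef (fps_of_mpoly p) i = (msubst p)`_i.
Proof. by apply: msubst_agree => m mi; rewrite mcoeff_trunc. Qed.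

Lemma subst_coefD f g i :
  subst_coef (f + g) i = subst_coef f i + subst_coef g i.
Proof.
rewrite /subst_coef -coefD /msubst -rmorphD; apply: msubst_agree => m mi.
by rewrite mcoeffD !mcoeff_trunc.
Qed.

Lemma subst_coefM f g i :
  subst_coef (f * g) i = \sum_(j < i.+1) subst_coef f j * subst_coef g (i - j).
Proof.
rewrite /subst_coef (@msubst_agree _ (fps_trunc i.+1 f * fps_trunc i.+1 g));
  last first.
  by move=> m mi; rewrite fps_trunc_mul.
rewrite msubstM coefM; apply: eq_bigr => j _.
by rewrite -!subst_coefE // ltnS leq_subr.
Qed.

Definition vanishes f := forall i, subst_coef f i = 0.

Lemma vanishesD f g : vanishes f -> vanishes g -> vanishes (f + g).
Proof. by move=> F G i; rewrite subst_coefD F G addr0. Qed.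

Lemma vanishesM f g : vanishes g -> vanishes (f * g).
Proof. by move=> G i; rewrite subst_coefM big1 // => j _; rewrite G mulr0. Qed.

Lemma vanishes_sum (I : Type) (s : seq I) (F : I -> fpser n K) :
  (forall i, vanishes (F i)) -> vanishes (\sum_(i <- s) F i).
Proof.
move=> h; elim/big_ind: _ => [i|? ?|//]; last exact: vanishesD.
by have /eqP := subst_coefD 0 0 i;
  rewrite addr0 -subr_eq0 opprD addrA subrr sub0r oppr_eq0 => /eqP.
Qed.

(** The ring of formal power series in t is a domain: look at the first
    nonzero coefficients. *)
Lemma vanishes_prime f g : vanishes (f * g) -> vanishes f \/ vanishes g.
Proof.
move=> fg; apply: contrapT => /not_orP[nf ng].
have ex h : ~ vanishes h -> exists i, subst_coef h i != 0.
  by move=> /existsNP[i /eqP]; exists i.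
case: (ex_minnP (ex _ nf)) => i fi mini;
  case: (ex_minnP (ex _ ng)) => j gj minj.
have /eqP := fg (i + j)%N; rewrite subst_coefM.
have iij : (i < (i + j).+1)%N by rewrite ltnS leq_addr.
rewrite (bigD1 (Ordinal iij)) //= addKn big1 ?addr0.
  by rewrite mulf_eq0 (negPf fi) (negPf gj).
move=> k; rewrite -val_eqE /= => ki.
case: (ltngtP k i) ki => // ki _.
  have -> : subst_coef f k = 0 by apply/eqP; apply: contraTT ki => /mini;
    rewrite -leqNgt.
  by rewrite mul0r.
have -> : subst_coef g (i + j - k) = 0.
  by apply/eqP; apply: contraTT ki => /minj; have := ltn_ord k; lia.
by rewrite mulr0.
Qed.

(** A single term of least weight cannot be cancelled after substitution. *)
Lemma subst_coef_lead f m :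
  (forall m', f m' != 0 -> m' = m \/ (wt w m < wt w m')%N) ->
  subst_coef f (wt w m) = f m.
Proof.
move=> h; rewrite /subst_coef /fps_trunc /msubst raddf_sum coef_sum /=.
have mm : (mdeg m < (wt w m).+1)%N by rewrite ltnS mdeg_le_wt.
have lt_w : (wt w m < wt w m + D)%N by rewrite -[X in (X < _)%N]addn0 ltn_add2l.
rewrite (bigD1 (BMultinom mm)) //= mmapZ coefCM msubstX_coef // eqxx mulr1.
rewrite big1 ?addr0 // => k; rewrite -val_eqE /= => km.
rewrite mmapZ coefCM; have [->|fk] := eqVneq (f k) 0; first by rewrite mul0r.
case: (h _ fk) => [e|l]; first by rewrite e eqxx in km.
by rewrite msubstX_coef ?ltn_addr // ltn_eqF // mulr0.
Qed.

(** If the terms of f have pairwise different weights, then the orders in t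
    of their images are pairwise different too. *)
Lemma vanishes_sep f :
  (forall m m', f m != 0 -> f m' != 0 -> wt w m = wt w m' -> m = m') ->
  vanishes f -> f = 0.
Proof.
move=> sep V; apply: fpserP => m; have [d] := ubnP (wt w m).
elim: d m => // d IH m; rewrite ltnS => md.
have [//|fm] := eqVneq (f m) 0; rewrite -subst_coef_lead ?V // => m' fm'.
case: (ltngtP (wt w m) (wt w m')) => [|lt|e]; [by right| |by left; apply: sep].
by rewrite IH ?fps0 ?eqxx // in fm'; apply: leq_trans md.
Qed.
End Evaluation.

Lemma fps_subst_coefE n (K : fieldType) (phi : 'I_n -> {poly K})
    (f : fpser n K) d :
  fps_subst phi f d = subst_coef phi f (mdeg d).
Proof.
rewrite /subst_coef /fps_trunc /msubst raddf_sum coef_sum /=;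
  apply: eq_bigr => m _.
by rewrite mmapZ coefCM mmapX.
Qed.

(** * Elements of large order lie in the ring of the curve *)

Section Representation.
Local Open Scope ring_scope.
Variables (n : nat) (K : fieldType).

(** Families indexed by an additional first variable t and n old ones. *)
Definition cons_fun (A : Type) (a : A) (F : 'I_n -> A) (i : 'I_n.+1) : A :=
  if unlift ord0 i is Some j then F j else a.

Definition mcons (e : nat) (m : 'X_{1..n}) : 'X_{1..n.+1} :=
  [multinom cons_fun e m i | i < n.+1].

Definition mrest (m : 'X_{1..n.+1}) : 'X_{1..n} :=
  [multinom m (lift ord0 j) | j < n].

Lemma cons_fun0 (A : Type) (a : A) F : cons_fun a F ord0 = a.
Proof. by rewrite /cons_fun unlift_none. Qed.

Lemma cons_funS (A : Type) (a : A) F j : cons_fun a F (lift ord0 j) = F j.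
Proof. by rewrite /cons_fun liftK. Qed.

Lemma mcons0 e m : mcons e m ord0 = e.
Proof. by rewrite mnmE cons_fun0. Qed.

Lemma mconsS e m j : mcons e m (lift ord0 j) = m j.
Proof. by rewrite mnmE cons_funS. Qed.

Lemma mrest_cons e m : mrest (mcons e m) = m.
Proof. by apply/mnmP => j; rewrite mnmE mconsS. Qed.

Lemma mcons_rest (m : 'X_{1..n.+1}) : mcons (m ord0) (mrest m) = m.
Proof.
apply/mnmP => i; case: (unliftP ord0 i) => [j|] ->.
  by rewrite mconsS mnmE.
by rewrite mcons0.
Qed.

Lemma mrestD m m' : mrest (m + m') = (mrest m + mrest m')%MM.
Proof. by apply/mnmP => j; rewrite !mnmE. Qed.

Lemma wt_cons v0 v (m : 'X_{1..n.+1}) :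
  wt (cons_fun v0 v) m = (v0 * m ord0 + wt v (mrest m))%N.
Proof.
rewrite /wt big_ord_recl cons_fun0; congr (_ + _)%N.
by apply: eq_bigr => j _; rewrite cons_funS mnmE.
Qed.

Lemma mdeg_cons0 m : mdeg (mcons 0 m) = mdeg m.
Proof.
rewrite !mdegE big_ord_recl mcons0 add0n.
by apply: eq_bigr => j _; rewrite mconsS.
Qed.

Lemma mdeg_rest m : (mdeg (mrest m) <= mdeg m)%N.
Proof.
rewrite !mdegE big_ord_recl; apply: leq_trans (leq_addl _ _).
by apply: leq_sum => j _; rewrite mnmE.
Qed.

Definition tpoly (p : {poly K}) : {mpoly K[n.+1]} :=
  \sum_(i < size p) p`_i *: 'X_[mcons i 0].

Lemma tpoly_neq0 p (m : 'X_{1..n.+1}) : (tpoly p)@_m != 0 ->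
  exists2 i, m = mcons i 0 & p`_i != 0.
Proof.
move=> h; apply: contrapT => no; case/eqP: h.
rewrite /tpoly raddf_sum big1 // => i _ /=; rewrite mcoeffZ mcoeffX.
case: (_ =P m) => [e|]; last by rewrite mulr0.
rewrite mulr1; apply/eqP; rewrite -[_ == 0]negbK; apply/negP => pi.
by apply: no; exists i.
Qed.

Variables (phi : 'I_n -> {poly K}) (w : 'I_n -> nat) (D : nat).
Hypothesis w_gt0 : forall j, (0 < w j)%N.
Hypothesis D_gt0 : (0 < D)%N.
Hypothesis phiP : forall j, near_mono (w j) D (phi j).

Lemma msubstX_cons e m :
  msubst (cons_fun 'X phi) 'X_[mcons e m] = 'X^e * msubst phi 'X_[m].
Proof.
rewrite !msubstX big_ord_recl mcons0 cons_fun0; congr (_ * _).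
by apply: eq_bigr => j _; rewrite mconsS cons_funS.
Qed.

Lemma msubstX0 : msubst phi 'X_[0%MM] = 1.
Proof. by rewrite msubstX big1 // => j _; rewrite mnm0E expr0. Qed.

Lemma msubst_tpoly p : msubst (cons_fun 'X phi) (tpoly p) = p.
Proof.
rewrite {1}/msubst /tpoly raddf_sum /= -[RHS]coefK poly_def;
  apply: eq_bigr => i _.
by rewrite mmapZ -/(msubst _ _) msubstX_cons msubstX0 mulr1 mul_polyC.
Qed.

Lemma near_mono_cons j : near_mono (cons_fun 1%N w j) D (cons_fun 'X phi j).
Proof.
case: (unliftP ord0 j) => [i|] ->; rewrite ?cons_funS ?cons_fun0 //.
by exists 0; rewrite mulr0 addr0 mulr1.
Qed.

Lemma cons_fun_gt0 v j : (forall i, 0 < v i)%N -> (0 < cons_fun 1%N v j)%N.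
Proof. by case: (unliftP ord0 j) => [i|] ->; rewrite ?cons_funS ?cons_fun0. Qed.

(** A series without t may be evaluated in the old variables. *)
Lemma subst_coef_cons (f : fpser n.+1 K) :
  (forall m, f m != 0 -> m ord0 = 0%N) -> forall i,
  subst_coef (cons_fun 'X phi) f i =
  subst_coef phi (FPSer (fun m => f (mcons 0 m))) i.
Proof.
move=> f0 i; rewrite /subst_coef /fps_trunc /msubst !raddf_sum !coef_sum /=.
rewrite (bigID (fun m : 'X_{1..n.+1 < i.+1} => m ord0 == 0%N)) /=.
rewrite [X in _ + X]big1 ?addr0; last first.
  move=> m m0; rewrite mmapZ coefCM (_ : f m = 0) ?mul0r //.
  by apply/eqP; apply: contraNT m0 => /f0 ->.
have b1 (m : 'X_{1..n < i.+1}) : (mdeg (mcons 0 m) < i.+1)%N.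
  by rewrite mdeg_cons0 bmdeg.
have b2 (m : 'X_{1..n.+1 < i.+1}) : (mdeg (mrest m) < i.+1)%N.
  exact: leq_ltn_trans (mdeg_rest m) (bmdeg m).
rewrite (reindex_onto (fun m => BMultinom (b1 m))
                      (fun m => BMultinom (b2 m))) /=.
  apply: eq_big => m; last first.
    by move=> _;
      rewrite !mmapZ !coefCM -!/(msubst _ _) msubstX_cons expr0 mul1r.
  by rewrite mcons0 eqxx -val_eqE /= mrest_cons eqxx.
by move=> m /eqP m0; apply: val_inj; rewrite /= -[RHS]mcons_rest m0.
Qed.

Variables (R : realType) (abs : absvalue K R).
Variables (x0 : 'I_n) (gamma kappa w0 : nat) (p : {poly K}).
Hypothesis gamma_gt0 : (0 < gamma)%N.
Hypothesis gammaP :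
  forall i, (gamma <= i)%N -> exists m : 'X_{1..n}, wt w m = i.
Hypothesis w0_ge : (gamma + kappa * w x0 <= w0)%N.
Hypothesis p_ord : forall i, (i < w0)%N -> p`_i = 0.

Let l := w x0.

(** In the ring of convergent series in t and the old variables, the
    substitution t := t, x_j := phi_j annihilates the elements
      t^l - x + (phi_x0(t) - t^l)   and   t^i - M_i + (M_i(phi)(t) - t^i)
    for gamma <= i < gamma + l, where l = w x0, x = x_x0, and M_i is a
    monomial of weight i. Dividing p(t) by them, with the first one used
    only on t^i for i >= gamma + l, trades all powers of t for monomials in
    the old variables. When some M_i comes in, the exponent of t has
    dropped below gamma + l, so at least kappa factors x have been split
    off. Convergence of h is the content of the division theorem. *)
Lemma representation : exists h : fpser n K,
  [/\ convergent abs h, wt_ge w (w0 - kappa * w x0) h &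
      forall i, subst_coef phi (h * fps_mono K (U_(x0) *+ kappa)%MM) i = p`_i].
Proof.
have [M MP] : exists M : nat -> 'X_{1..n},
    forall i, (gamma <= i)%N -> wt w (M i) = i.
  have /choice[M hM] :
      forall i, exists m : 'X_{1..n}, (gamma <= i)%N -> wt w m = i.
    move=> i; case: (leqP gamma i) => h; last by exists 0%MM.
    by have [m hm] := gammaP h; exists m.
  by exists M.
(* The index None stands for the divisor with lead t^l, and Some k for the one
   with lead t^(gamma + k). *)
pose lead (j : option 'I_l) := if j is Some k then (gamma + k)%N else l.
pose N (j : option 'I_l) : 'X_{1..n} :=
  if j is Some k then M (gamma + k)%N else U_(x0)%MM.
pose q j : {poly K} := msubst phi 'X_[N j] - 'X^(lead j).
pose g j := fps_of_mpoly ('X_[mcons 0 (N j)] - tpoly (q j)).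
pose mu j := mcons (lead j) 0.
(* Adding 1 to the weights of the old variables makes the monomials x and M_i
   heavier than t^l and t^i. *)
pose om := cons_fun 1%N (fun j => (w j).+1).
pose sel (m : 'X_{1..n.+1}) : option (option 'I_l) :=
  if (m ord0 < gamma)%N then None else Some (insub (m ord0 - gamma)%N).
have wtN j : wt w (N j) = lead j.
  case: j => [k|] /=; first by rewrite MP // leq_addr.
  rewrite /wt (bigD1 x0) //= mnm1E eqxx muln1 big1 ?addn0 // => i /negPf ix.
  by rewrite mnm1E eq_sym ix muln0.
have lead_gt0 j : (0 < lead j)%N.
  by case: j => [k|] /=; [rewrite addn_gt0 gamma_gt0|exact: w_gt0].
have qP j i : (q j)`_i != 0 -> (lead j < i)%N.
  apply: contraNT; rewrite -leqNgt => ij; rewrite coefB coefXn.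
  rewrite (msubstX_coef phiP) wtN ?subrr //; apply: leq_ltn_trans ij _.
  by rewrite -[X in (X < _)%N]addn0 ltn_add2l.
have gP j k : g j k != 0 -> k = mcons 0 (N j) \/
    exists2 e, k = mcons e 0 & (lead j < e)%N.
  rewrite /= mcoeffB mcoeffX; case: (_ =P k) => [e|_]; first by left.
  rewrite sub0r oppr_eq0 => /tpoly_neq0[e -> /qP]; by right; exists e.
have wt_om m : wt om m = (m ord0 + wt w (mrest m) + mdeg (mrest m))%N.
  rewrite /om wt_cons mul1n -addnA; congr (_ + _)%N.
  rewrite mdegE /wt -big_split; apply: eq_bigr => i _ /=.
  by rewrite mulSn addnC.
have wt0 v : wt v (0%MM : 'X_{1..n}) = 0%N by rewrite /wt big1 // => i _;
  rewrite mnm0E muln0.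
have sel_le m j : sel m = Some j -> (mu j <= m)%MM.
  rewrite /sel; case: ltnP => // mg [<-]; apply/mnm_lepP => i.
  case: (unliftP ord0 i) => [k|] ->; first by rewrite mconsS mnm0E.
  by rewrite mcons0; case: insubP => [k _ /= ->|/=];
    rewrite ?subnKC // -leqNgt => h; apply: leq_trans h (leq_subr _ _).
have g_wt j : wt_ge om (wt om (mu j)).+1 (g j).
  move=> k; rewrite (wt_om (mu j)) mcons0 mrest_cons wt0 mdeg0 !addn0 => kj.
  apply/eqP; apply: contraTT kj => /gP; rewrite -leqNgt wt_om.
  case=> [->|[e -> je]]; last first.
    by rewrite mcons0 mrest_cons wt0 mdeg0 !addn0.
  rewrite mcons0 mrest_cons wtN add0n -addn1 leq_add2l lt0n mdeg_eq0.
  by apply/eqP => N0; have := wtN j; rewrite N0 wt0 => e; have := lead_gt0 j;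
    rewrite -e.
(* The invariant of the reduction: either t is still present to a power at
   least gamma and trading it for x would yield at least kappa factors x, or t
   is gone and they are there.  The second part bounds the weight of h. *)
pose S (m : 'X_{1..n.+1}) :=
  ((gamma <= m ord0 /\ gamma + kappa * l <= m ord0 + l * m (lift ord0 x0)) \/
   (m ord0 = 0 /\ kappa <= m (lift ord0 x0)))%N /\
  (w0 <= m ord0 + wt w (mrest m))%N.
have Sf m : fps_of_mpoly (tpoly p) m != 0 -> S m.
  move=> /tpoly_neq0[i -> pi];
    rewrite /S mcons0 mconsS mrest_cons wt0 mnm0E muln0 !addn0.
  have iw : (w0 <= i)%N by apply: contraNT pi; rewrite -ltnNge => /p_ord ->.
  by split=> //; left; have := w0_ge; rewrite -/l; lia.
have Sg m j k : S m -> sel m = Some j -> g j k != 0 -> S (m - mu j + k)%MM.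
  move=> Sm sm gk; have le := sel_le m j sm.
  have E := submK le; have E0 : ((m - mu j)%MM ord0 + lead j = m ord0)%N.
    by rewrite -[in RHS]E mnmDE [mu j ord0]mcons0.
  have Er : mrest m = mrest (m - mu j)%MM.
    by rewrite -{1}E mrestD mrest_cons addm0.
  have Ex : (m - mu j)%MM (lift ord0 x0) = m (lift ord0 x0).
    by rewrite -[in RHS]E mnmDE [mu j (lift _ _)]mconsS mnm0E addn0.
  move: Sm; rewrite /S mrestD wtD !mnmDE Er -E0 -Ex.
  move: (m - mu j)%MM sm E0 => d sm E0 [A B]; split; last first.
    case: (gP j k gk) => [->|[e -> je]]; rewrite ?mcons0 ?mrest_cons ?wtN ?wt0;
      lia.
  move: sm; rewrite /sel; case: ltnP => // mg [jE].
  case: A => [[A1 A2]|[A1 _]]; last by move: (lead_gt0 j); lia.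
  case: (gP j k gk) => [->|[e -> je]]; last first.
    left; rewrite mcons0 mconsS mnm0E; split; last by lia.
    by move: jE je E0; case: insubP => [i /= i1 i2 <-|/= i1 <-] /=; lia.
  rewrite mcons0 mconsS !addn0.
  move: jE E0 A1 A2; case: insubP => [i /= i1 i2 <- /=|/= i1 <- /=] E0 A1 A2.
    right; split; first by lia.
    apply: leq_trans (leq_addr _ _); rewrite leqNgt; apply/negP => lt.
    have : (l * (d (lift ord0 x0)).+1 <= l * kappa)%N.
      by rewrite leq_mul2l lt orbT.
    by move: i1 A2 i2; rewrite -E0 mulnS; lia.
  left; rewrite mnm1E eqxx; split; first by lia.
  by rewrite mulnDr muln1; lia.
have om_gt0 j : (0 < om j)%N by apply: cons_fun_gt0.
have [Q [rem [_ crem divE remP]]] := division om_gt0 sel_le g_wt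
  (fun j => convergent_mpoly abs _) (convergent_mpoly abs (tpoly p)) Sf Sg.
have rem0 m : rem m != 0 ->
    [/\ m ord0 = 0, kappa <= m (lift ord0 x0) & w0 <= wt w (mrest m)]%N.
  move=> /remP[]; rewrite /S /sel; case: ltnP => // mg [A B] _.
  by case: A => [|[]]; [lia|move=> m0 A; rewrite m0 in B].
pose H : fpser n K := FPSer (fun m => rem (mcons 0 m)).
have cH : convergent abs H.
  move/convergentP: crem => [C [L [L0 hL]]]; apply/convergentP; exists C, L;
    split=> // m.
  by rewrite -mdeg_cons0; exact: hL.
exists (FPSer (fun m => H (m + U_(x0) *+ kappa)%MM)); split.
- exact: convergent_shift.
- move=> m mw; apply/eqP; apply: contraTT mw => /rem0[_ _].
  rewrite mrest_cons wtD -leqNgt leq_subLR addnC.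
  congr (_ <= _ + _)%N;
    rewrite /wt (bigD1 x0) //= mulmnE mnm1E eqxx mul1n mulnC.
  by rewrite big1 ?addn0 // => i /negPf ix;
    rewrite mulmnE mnm1E eq_sym ix mul0n muln0.
set h := FPSer _; have -> : h * fps_mono K (U_(x0) *+ kappa) = H.
  apply: fpserP => m; case: (boolP (U_(x0) *+ kappa <= m)%MM) => le.
    by rewrite -(submK le) fps_mulmono.
  rewrite fps_mulmono0 //; apply/esym/eqP; apply: contraNT le => /rem0[_ kx _].
  apply/mnm_lepP => i; rewrite mulmnE mnm1E; case: (x0 =P i) => [<-|_] //.
  by rewrite mul1n -(mconsS 0).
move=> i; rewrite -subst_coef_cons; last by move=> m /rem0[].
have cw j : (0 < cons_fun 1%N w j)%N by exact: cons_fun_gt0.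
have cp := near_mono_cons.
rewrite -[in RHS](msubst_tpoly p) -(subst_coef_mpoly cw cp) divE
  (subst_coefD cw cp).
rewrite (_ : subst_coef _ (\sum_j _) i = 0) ?add0r //.
apply: (vanishes_sum cw cp) => j; apply: (vanishesM cw cp) => {}i.
rewrite /fps_mono /g -fps_of_mpolyB
  (subst_coef_mpoly cw cp) !msubstB !msubstX_cons msubst_tpoly.
by rewrite msubstX0 mulr1 expr0 mul1r /q subKr subrr coef0.
Qed.
End Representation.

(** * Arithmetic of Herzog relations *)

Section Herzog.
Local Open Scope nat_scope.

Lemma minimal_multipleC a l m n :
  minimal_multiple a l m n -> minimal_multiple a l n m.
Proof.
move=> [a0 [u [v e]] min]; split=> // [|a' a'0 [u' [v' e']]].
  by exists v, u; rewrite e addnC.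
by apply: min => //; exists v', u'; rewrite e' addnC.
Qed.

Lemma minimal_multiple_le a l m n a' u v : minimal_multiple a l m n ->
  0 < a' -> a' * l = u * m + v * n -> a <= a'.
Proof. by move=> [_ _ min] a'0 e; apply: min => //; exists u, v. Qed.

(** Subtracting r * l on both sides would give a smaller relation. *)
Lemma minimal_multiple_no_self a l m n u v r : minimal_multiple a l m n ->
  0 < l -> 0 < r -> 0 < u * m + v * n -> a * l = u * m + v * n + r * l -> False.
Proof.
move=> min l0 r0 uv e;
  have ra : r < a by rewrite -(ltn_pmul2r l0) e -[ltnLHS]add0n ltn_add2r.
have : a <= a - r.
  apply: (minimal_multiple_le (u := u) (v := v) min); first by rewrite subn_gt0.
  by rewrite mulnBl e addnK.
by rewrite leqNgt ltn_subrL r0 (leq_ltn_trans _ ra).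
Qed.

(** If a <= a1, replacing a * l in the relation for c by the other side of
    the relation for a makes n reappear on the right of a minimal relation
    for n. *)
Lemma exchange_lt a l m n c a1 b1 b2 c2 : 0 < m -> 0 < n ->
  minimal_multiple c n l m -> 0 < b1 -> 0 < c2 ->
  a * l = b1 * m + c2 * n -> c * n = a1 * l + b2 * m -> a1 < a.
Proof.
move=> m0 n0 min b10 c20 ea ec; rewrite ltnNge; apply/negP => le.
apply: (minimal_multiple_no_self (u := a1 - a) (v := b1 + b2) (r := c2) min)
  => //.
  by rewrite addn_gt0 !muln_gt0 addn_gt0 b10 m0 orbT.
by rewrite ec -{1}(subnK le) !mulnDl ea; lia.
Qed.

Variables (l m n a b c a1 a2 b1 b2 c1 c2 : nat).
Hypotheses (l_gt0 : 0 < l) (m_gt0 : 0 < m) (n_gt0 : 0 < n).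
Hypothesis H : herzog_H1 l m n a b c a1 a2 b1 b2 c1 c2.

(** Adding two of the three relations shows that a <= a1 + a2, and likewise
    for b and c; the sum of all three relations then turns these
    inequalities into equalities. *)
Lemma herzog_sums : [/\ a = a1 + a2, b = b1 + b2 & c = c1 + c2].
Proof.
case: H => ma mb mc ea eb ec [a1p a2p] [b1p b2p] [c1p c2p].
have mb' := minimal_multipleC mb; have ma' := minimal_multipleC ma.
have mc' := minimal_multipleC mc.
have ea' := etrans ea (addnC _ _); have eb' := etrans eb (addnC _ _).
have ec' := etrans ec (addnC _ _).
have a1a := exchange_lt m_gt0 n_gt0 mc b1p c2p ea ec.
have a2a := exchange_lt n_gt0 m_gt0 mb c2p b1p ea' eb.
have b1b := exchange_lt n_gt0 l_gt0 ma c1p a2p eb' ea.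
have b2b := exchange_lt l_gt0 n_gt0 mc' a2p c1p eb ec'.
have c1c := exchange_lt l_gt0 m_gt0 mb' a1p b2p ec eb'.
have c2c := exchange_lt m_gt0 l_gt0 ma' b2p a1p ec' ea'.
have mul_le x y p : x < y -> x * p <= y * p by move=> xy;
  rewrite leq_mul2r ltnW ?orbT.
have := (mul_le _ _ l a1a, mul_le _ _ l a2a, mul_le _ _ m b1b, mul_le _ _ m b2b,
         mul_le _ _ n c1c, mul_le _ _ n c2c)
           => -[[[[[Ha1 Ha2] Hb1] Hb2] Hc1] Hc2].
have la : a <= a1 + a2.
  apply: (minimal_multiple_le (u := b - b2) (v := c - c1) ma); first by lia.
  by rewrite mulnDl !mulnBl; lia.
have lb : b <= b1 + b2.
  apply: (minimal_multiple_le (u := a - a1) (v := c - c2) mb); first by lia.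
  by rewrite mulnDl !mulnBl; lia.
have lc : c <= c1 + c2.
  apply: (minimal_multiple_le (u := a - a2) (v := b - b1) mc); first by lia.
  by rewrite mulnDl !mulnBl; lia.
have La : a * l <= (a1 + a2) * l by rewrite leq_mul2r la orbT.
have Lb : b * m <= (b1 + b2) * m by rewrite leq_mul2r lb orbT.
have Lc : c * n <= (c1 + c2) * n by rewrite leq_mul2r lc orbT.
rewrite !mulnDl in La Lb Lc.
split; apply/eqP.
- by rewrite -(eqn_pmul2r l_gt0) mulnDl; apply/eqP; lia.
- by rewrite -(eqn_pmul2r m_gt0) mulnDl; apply/eqP; lia.
- by rewrite -(eqn_pmul2r n_gt0) mulnDl; apply/eqP; lia.
Qed.

(** The monomials y^i z^j outside the ideal (y^b, z^c, y^b1 z^c2) of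
    leading monomials. *)
Definition standard i j := [&& i < b, j < c & ~~ ((b1 <= i) && (c2 <= j))].

(** After cancelling common factors, the relation expresses a multiple of
    l, m or n by the other two generators. For m and n this contradicts the
    minimality of b and c; for q * l one first subtracts the relation for
    a. *)
Lemma standard_shift_eq q i j i' j' : standard i j ->
  i * m + j * n = q * l + i' * m + j' * n -> [/\ q = 0, i = i' & j = j'].
Proof.
case: H => ma mb mc ea eb ec [a1p a2p] [b1p b2p] [c1p c2p].
move=> /and3P[ib jc nij] e; have Q0 := leq0n (q * l).
case: (leqP i' i) => ii'; case: (leqP j' j) => jj'.
- have [i2 ei] : exists i2, i = i' + i2 by exists (i - i'); lia.
  have [j2 ej] : exists j2, j = j' + j2 by exists (j - j'); lia.
  have {}e : i2 * m + j2 * n = q * l by move: e; rewrite ei ej !mulnDl; lia.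
  case: (posnP q) => q0.
    have /eqP : i2 * m + j2 * n = 0 by rewrite e q0.
    rewrite addn_eq0 !muln_eq0 -!leqn0 !(leqNgt _ 0) m_gt0 n_gt0 !orbF -!leqNgt.
    by rewrite !leqn0 ei ej => /andP[/eqP-> /eqP->]; rewrite !addn0.
  have aq : a <= q by apply: (minimal_multiple_le ma q0); exact: esym e.
  have {}e : i2 * m + j2 * n = (q - a) * l + b1 * m + c2 * n.
    by rewrite e -{1}(subnK aq) mulnDl ea addnA.
  have D0 := leq0n ((q - a) * l).
  exfalso; case: (leqP b1 i2) => bi; case: (leqP c2 j2) => cj.
  + by case/negP: nij; rewrite ei ej; apply/andP; split; lia.
  + have : b <= i2 - b1.
      apply: (minimal_multiple_le (u := q - a) (v := c2 - j2) mb).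
        rewrite subn_gt0 ltn_neqAle bi andbT; apply/eqP => be; move: e;
          rewrite -be.
        have : j2 * n < c2 * n by rewrite ltn_pmul2r.
        lia.
      move: e; have := leq_mul bi (leqnn m);
        have := leq_mul (ltnW cj) (leqnn n).
      by rewrite !mulnBl; lia.
    by lia.
  + have : c <= j2 - c2.
      apply: (minimal_multiple_le (u := q - a) (v := b1 - i2) mc).
        rewrite subn_gt0 ltn_neqAle cj andbT; apply/eqP => be; move: e;
          rewrite -be.
        have : i2 * m < b1 * m by rewrite ltn_pmul2r.
        lia.
      move: e; have := leq_mul cj (leqnn n);
        have := leq_mul (ltnW bi) (leqnn m).
      by rewrite !mulnBl; lia.
    by lia.
  + have : i2 * m < b1 * m by rewrite ltn_pmul2r.
    have : j2 * n < c2 * n by rewrite ltn_pmul2r.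
    by move: e; lia.
- have : b <= i - i'.
    apply: (minimal_multiple_le (u := q) (v := j' - j) mb).
      rewrite subn_gt0 ltn_neqAle ii' andbT; apply/eqP => be; move: e;
        rewrite -be.
      have : j * n < j' * n by rewrite ltn_pmul2r.
      lia.
    move: e; have := leq_mul ii' (leqnn m);
      have := leq_mul (ltnW jj') (leqnn n).
    by rewrite !mulnBl; lia.
  by lia.
- have : c <= j - j'.
    apply: (minimal_multiple_le (u := q) (v := i' - i) mc).
      rewrite subn_gt0 ltn_neqAle jj' andbT; apply/eqP => be; move: e;
        rewrite -be.
      have : i * m < i' * m by rewrite ltn_pmul2r.
      lia.
    move: e; have := leq_mul jj' (leqnn n);
      have := leq_mul (ltnW ii') (leqnn m).
    by rewrite !mulnBl; lia.
  by lia.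
- have : i * m < i' * m by rewrite ltn_pmul2r.
  have : j * n < j' * n by rewrite ltn_pmul2r.
  by move: e; lia.
Qed.

Lemma standard_weight_inj p i j p' i' j' : standard i j -> standard i' j' ->
  p * l + i * m + j * n = p' * l + i' * m + j' * n ->
  [/\ p = p', i = i' & j = j'].
Proof.
move=> st st' e; case: (leqP p p') => pp'.
  have [|d0 -> ->] := @standard_shift_eq (p' - p) i j i' j' st.
    by have := leq_mul pp' (leqnn l); rewrite mulnBl; lia.
  by split=> //; lia.
have [|d0 -> ->] := @standard_shift_eq (p - p') i' j' i j st'.
  by have := leq_mul (ltnW pp') (leqnn l); rewrite mulnBl; lia.
by split=> //; lia.
Qed.

(** Otherwise 1 lies in the semigroup, hence is one of its generators, and
    the two other generators are multiples of it; but b = b1 + b2 and a =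
    a1 + a2 exceed 1. *)
Lemma conductor_gt0 gamma : is_conductor (semigroup3 l m n) gamma -> 0 < gamma.
Proof.
case: H => ma mb mc ea eb ec [a1p a2p] [b1p b2p] [c1p c2p].
have [sa sb sc] := herzog_sums.
move=> [cond _]; rewrite lt0n; apply/eqP => g0.
have [i [j [k e]]] : semigroup3 l m n 1 by apply: cond; rewrite g0.
have : l = 1 \/ m = 1 \/ n = 1.
  case: i e => [|i] e; last by left; move: e; rewrite mulSn; lia.
  case: j e => [|j] e; last by right; left; move: e; rewrite mulSn; lia.
  by case: k e => [|k] e; [lia|right; right; move: e; rewrite mulSn; lia].
case=> [l1|[m1|n1]].
- by have : b <= 1; [apply: (minimal_multiple_le (u := m) (v := 0) mb) => //;
  rewrite l1; lia|lia].
- by have : a <= 1; [apply: (minimal_multiple_le (u := l) (v := 0) ma) => //;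
  rewrite m1; lia|lia].
- by have : a <= 1; [apply: (minimal_multiple_le (u := 0) (v := l) ma) => //;
  rewrite n1; lia|lia].
Qed.
End Herzog.

(** * Minors of a 2x3 matrix and set-theoretic complete intersections *)

Section DeterminantalCI.
Local Open Scope ring_scope.
Variable A : comNzRingType.

Definition ideal_closed (I : set A) :=
  (forall x y, I x -> I y -> I (x + y)) /\ (forall r x, I x -> I (r * x)).

Lemma ideal_closed_ideal2 (f g : A) : ideal_closed (ideal2 f g).
Proof.
split=> [x y [u [v ->]] [u' [v' ->]]|r x [u [v ->]]].
  by exists (u + u'), (v + v'); ring.
by exists (r * u), (r * v); ring.
Qed.

Section Radical.
Variable I : set A.
Hypothesis idI : ideal_closed I.

Lemma ideal_radical x : I x -> radical I x.
Proof. by move=> Ix; exists 1%N; rewrite expr1. Qed.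

Lemma radicalM r x : radical I x -> radical I (r * x).
Proof. by move=> [q h]; exists q; rewrite exprMn; apply: idI.2. Qed.

Lemma radical_exp k x : radical I (x ^+ k) -> radical I x.
Proof. by move=> [q h]; exists (k * q)%N; rewrite exprM. Qed.

(** In the binomial expansion of (x + y)^(p + q) every term is divisible by
    x^p or by y^q. *)
Lemma radicalD x y : radical I x -> radical I y -> radical I (x + y).
Proof.
move=> [p hx] [q hy]; exists (p + q)%N; rewrite exprDn.
have I0 : I 0 by rewrite -(mul0r (x ^+ p)); exact: idI.2.
elim/big_ind: _ => [//||i _]; first exact: idI.1.
rewrite -mulr_natl; apply: idI.2; case: (leqP q i) => qi.
  by rewrite -[in X in _ * X](subnK qi) exprD mulrA; apply: idI.2.
have pi : (p <= p + q - i)%N by lia.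
by rewrite -[in X in X * _](subnK pi) exprD mulrC mulrA; apply: idI.2.
Qed.
End Radical.

Lemma ideal_closed_radical (I : set A) :
  ideal_closed I -> ideal_closed (radical I).
Proof. by move=> idI; split=> [x y|r x]; [exact: radicalD|exact: radicalM]. Qed.

Variables (X Y z e v : A) (c1 c2 : nat).
Hypotheses (c1_gt0 : (0 < c1)%N) (c2_gt0 : (0 < c2)%N).
Let c := (c1 + c2)%N.
Let F1 := X * e - Y * z ^+ c2.
Let F2 := Y * v - z ^+ c1 * e.
Let F3 := X * v - z ^+ c.

Lemma minor_pow_reduction k : exists q, z ^+ (c * k) = X ^+ k * v ^+ k + F3 * q.
Proof.
elim: k => [|k [q IH]]; first by exists 0; rewrite muln0 !expr0; ring.
exists (z ^+ c * q - X ^+ k * v ^+ k).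
by rewrite mulnS exprD IH !exprS /F3; ring.
Qed.

(** Expand F1^c as the sum of (X e)^s (- Y z^c2)^(c - s) over s and replace
    z^c by X v modulo F3. For s = 0 this gives X^c2 (- Y)^c v^c2. For 0 < s
    <= c2 it gives X^s X^(c2 - s) = X^c2 times a multiple of z^(c1 s), and
    for s > c2 the factor X^s is divisible by X^(c2 + 1). So X^c2 splits
    off, and the cofactor G is (- Y)^c v^c2 up to multiples of X and z. *)
Lemma minor_power : exists G q g1 g2,
  F1 ^+ c = X ^+ c2 * G + F3 * q /\ G = (- Y) ^+ c * v ^+ c2 + X * g1 + z * g2.
Proof.
pose I : set A := [set h | exists g1 g2 q,
  h = X ^+ c2 * (X * g1 + z * g2) + F3 * q]%classic.
have idI : ideal_closed I.
  split=> [x y [g1 [g2 [q ->]]] [h1 [h2 [r ->]]]|r x [g1 [g2 [q ->]]]].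
    by exists (g1 + h1), (g2 + h2), (q + r); ring.
  by exists (r * g1), (r * g2), (r * q); ring.
have I0 : I 0 by exists 0, 0, 0; ring.
suff [g1 [g2 [q E]]] : I (F1 ^+ c - X ^+ c2 * ((- Y) ^+ c * v ^+ c2)).
  exists ((- Y) ^+ c * v ^+ c2 + X * g1 + z * g2), q, g1, g2; split=> //.
  by rewrite -[LHS](subrK (X ^+ c2 * ((- Y) ^+ c * v ^+ c2))) E; ring.
rewrite /F1 -mulNr exprDn big_ord_recr /= subnn expr0 mul1r binn mulr1n.
rewrite -addrA; apply: idI.1; last first.
  have [q E] := minor_pow_reduction c2; exists 0, 0, ((- Y) ^+ c * q).
  by rewrite exprMn -exprM mulnC E; ring.
elim/big_ind: _ => [//||i _]; first exact: idI.1.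
rewrite -mulr_natl; apply: idI.2; rewrite !exprMn.
have := ltn_ord i; move: (nat_of_ord i) => {}i ic;
  case: (leqP (c - i) c2) => h; last first.
  (* Here s = c - i > c2. *)
  have E : (c - i = c2 + 1 + (c - i - c2 - 1))%N by lia.
  exists (X ^+ (c - i - c2 - 1) * e ^+ (c - i) *
    ((- Y) ^+ i * z ^+ c2 ^+ i)), 0, 0.
  by rewrite [in X ^+ (c - i)]E !exprD; ring.
(* Here 0 < s = c - i <= c2, and c2 (c - s) = c (c2 - s) + c1 s. *)
have [q E] := minor_pow_reduction (c2 - (c - i)).
have -> : z ^+ c2 ^+ i = z ^+ (c * (c2 - (c - i))) * z ^+ (c1 * (c - i)).
  rewrite -exprM -exprD; congr (_ ^+ _).
  have [s si] : exists s, (c = i + s)%N by exists (c - i)%N; lia.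
  have [r sr] : exists r, (c2 = s + r)%N by exists (c2 - s)%N; lia.
  rewrite (_ : c - i = s)%N; last lia.
  rewrite (_ : c2 - s = r)%N; last lia.
  by move: si; rewrite /c sr => si; nia.
have E2 : (c1 * (c - i) = (c1 * (c - i)).-1.+1)%N by
  rewrite prednK // muln_gt0 c1_gt0; lia.
have E3 : (c2 = c2 - (c - i) + (c - i))%N by rewrite subnK.
rewrite E E2 exprS.
exists 0, (e ^+ (c - i) * (- Y) ^+ i * v ^+ (c2 - (c - i)) * z ^+ (c1 *
  (c - i)).-1).
exists (X ^+ (c - i) * e ^+ (c - i) * (- Y) ^+ i * z * z ^+ (c1 *
  (c - i)).-1 * q).
by rewrite [in X ^+ c2]E3 exprD; ring.
Qed.

(** F1, F2 and F3 are the 2x2 minors of the matrix with rows (X, Y, z^c1)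
    and (z^c2, e, v), and P is the radical of (G, F3). As X can be
    cancelled modulo P, G lies in P. Conversely a power of F1 lies in J =
    (G, F3); since X F2 = Y F3 - z^c1 F1, it remains to see that F2 is
    nilpotent modulo J + (X). There z^c = 0, and (Y v)^c is a multiple of
    (- Y)^c v^c2, which lies in J + (X, z); finally F2 = Y v - z^c1 e. *)
Theorem determinantal_stci (P : set A) : ideal_closed P ->
  P F1 -> P F2 -> P F3 ->
  (forall h, P h -> exists q1 q2 q3, h = q1 * F1 + q2 * F2 + q3 * F3) ->
  (forall h, P (X * h) -> P h) -> (forall h k, P (h ^+ k) -> P h) ->
  set_theoretic_ci P.
Proof.
move=> idP P1 P2 P3 gens cancelX radP.
have [G [q [g1 [g2 [EG defG]]]]] := minor_power.
have PN x : P x -> P (- x) by rewrite -mulN1r; exact: idP.2.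
have c_gt0 : (0 < c)%N by rewrite addn_gt0 c1_gt0.
have PG : P G.
  have : P (X ^+ c2 * G).
    have -> : X ^+ c2 * G = F1 ^+ c + (- q) * F3 by rewrite EG; ring.
    apply: idP.1; last exact: idP.2.
    by rewrite -(prednK c_gt0) exprSr; exact: idP.2.
  elim: (c2) => [|k IH]; first by rewrite expr0 mul1r.
  by rewrite exprS -mulrA => /cancelX.
exists G, F3; have idJ := ideal_closed_ideal2 G F3.
have idR := ideal_closed_radical idJ.
apply/seteqP; split=> h; last first.
  by move=> [k [u [w E]]]; apply: (radP h k); rewrite E; apply: idP.1;
    exact: idP.2.
have R3 : radical (ideal2 G F3) F3.
  by apply: ideal_radical; exists 0, 1; ring.
have R1 : radical (ideal2 G F3) F1.
  by apply: (radical_exp (k := c)); apply: ideal_radical; exists (X ^+ c2), q;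
    rewrite EG; ring.
pose JX : set A := [set x | exists u r, ideal2 G F3 u /\ x = u + X * r]%classic.
have idJX : ideal_closed JX.
  split=> [x y [u [r [Ju ->]]] [u' [r' [Ju' ->]]]|s x [u [r [Ju ->]]]].
    by exists (u + u'), (r + r'); split; [exact: idJ.1|ring].
  by exists (s * u), (s * r); split; [exact: idJ.2|ring].
have RX2 : radical JX F2.
  have idRX := ideal_closed_radical idJX.
  have zJX : radical JX z.
    exists c, ((-1) * F3), v; split; first by exists 0, (-1); ring.
    by rewrite /F3; ring.
  have YvJX : radical JX (Y * v).
    apply: (radical_exp (k := c)).
    have -> : (Y * v) ^+ c = (-1) ^+ c * v ^+ c1 * (G - X * g1)
                             + (- (-1) ^+ c * v ^+ c1 * g2) * z.
      transitivity ((-1) ^+ c * (-1) ^+ c * (Y ^+ c * v ^+ c)).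
        by rewrite -expr2 sqrr_sign mul1r exprMn.
      by rewrite defG [(- Y) ^+ c]exprNn [in v ^+ c]/c exprD;
        move: ((-1) ^+ c) => s; ring.
    apply: idRX.1; last exact: idRX.2.
    apply: idRX.2; apply: ideal_radical; exists G, (- g1).
    by split; [exists 1, 0; ring|ring].
  have -> : F2 = Y * v + (- z ^+ c1.-1 * e) * z.
    by rewrite /F2 -{1}(prednK c1_gt0) exprS; ring.
  by apply: idRX.1 => //; exact: idRX.2.
have R2 : radical (ideal2 G F3) F2.
  case: RX2 => k [u [r [Ju E]]]; apply: (radical_exp (k := k.+1)).
  have -> : F2 ^+ k.+1 = F2 * u + r * (Y * F3 + (- z ^+ c1) * F1).
    by rewrite exprS E /F1 /F2 /F3 /c exprD; ring.
  apply: idR.1; first by apply: idR.2; exact: ideal_radical.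
  by apply: idR.2; apply: idR.1; exact: idR.2.
move=> /gens[q1 [q2 [q3 ->]]].
by apply: idR.1; [apply: idR.1|]; exact: idR.2.
Qed.
End DeterminantalCI.

(** * Generators of the ideal of the curve *)

Section SpaceCurve.
Local Open Scope ring_scope.

Definition ix : 'I_3 := ord0.
Definition iy : 'I_3 := lift ord0 ord0.
Definition iz : 'I_3 := lift ord0 (lift ord0 ord0).

Lemma I3_ind (P : 'I_3 -> Prop) : P ix -> P iy -> P iz -> forall j, P j.
Proof.
move=> P0 P1 P2 [[|[|[|//]]] h].
- by rewrite (_ : Ordinal h = ix) //; apply: val_inj.
- by rewrite (_ : Ordinal h = iy) //; apply: val_inj.
- by rewrite (_ : Ordinal h = iz) //; apply: val_inj.
Qed.

Lemma big_I3 (T : Type) (idx : T) (op : Monoid.law idx) (F : 'I_3 -> T) :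
  \big[op/idx]_j F j = op (F ix) (op (F iy) (F iz)).
Proof. by rewrite !big_ord_recl big_ord0 Monoid.mulm1. Qed.

Definition weights3 (l m n : nat) : 'I_3 -> nat := tnth [tuple l; m; n].

Lemma wt_weights3 l m n (M : 'X_{1..3}) :
  wt (weights3 l m n) M = (l * M ix + m * M iy + n * M iz)%N.
Proof. by rewrite /wt big_I3 /= addnA. Qed.

Lemma wt_U n (w : 'I_n -> nat) i k : wt w (U_(i) *+ k)%MM = (w i * k)%N.
Proof.
rewrite /wt (bigD1 i) //= mulmnE mnm1E eqxx mul1n big1 ?addn0 // => j /negPf ji.
by rewrite mulmnE mnm1E eq_sym ji mul0n muln0.
Qed.

Lemma lem_U n (i : 'I_n) k (M : 'X_{1..n}) :
  (U_(i) *+ k <= M)%MM = (k <= M i)%N.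
Proof.
apply/mnm_lepP/idP => [/(_ i)|h j]; rewrite mulmnE mnm1E.
  by rewrite eqxx mul1n.
by case: eqP => [<-|_]; rewrite ?mul1n.
Qed.

Variables (K : fieldType).

Definition varX n (i : 'I_n) k : fpser n K := fps_mono K (U_(i) *+ k)%MM.

Lemma varX_exp n (i : 'I_n) k : varX i k = varX i 1 ^+ k.
Proof. by rewrite /varX /fps_mono -fps_of_mpolyX mpolyXn mulm1n. Qed.

Lemma varXD n (i : 'I_n) j k : varX i (j + k) = varX i j * varX i k.
Proof. by rewrite varX_exp exprD -!varX_exp. Qed.

Lemma wt_ge_varX n (w : 'I_n -> nat) (i : 'I_n) k :
  wt_ge w (w i * k) (varX i k).
Proof. by rewrite -wt_U; exact: wt_ge_mono. Qed.

Variables (R : realType) (abs : absvalue K R).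
Variables (l m n a b c a1 a2 b1 b2 c1 c2 : nat).
Hypotheses (l_gt0 : (0 < l)%N) (m_gt0 : (0 < m)%N) (n_gt0 : (0 < n)%N).
Hypothesis H1 : herzog_H1 l m n a b c a1 a2 b1 b2 c1 c2.
Variables (D : nat) (phi : 'I_3 -> {poly K}).
Hypothesis D_gt0 : (0 < D)%N.
Hypothesis phiP : forall j, near_mono (weights3 l m n j) D (phi j).

Lemma weights3_gt0 j : (0 < weights3 l m n j)%N.
Proof. by elim/I3_ind: j. Qed.

Variables h1 h3 : fpser 3 K.
Hypotheses (h1_conv : convergent abs h1) (h3_conv : convergent abs h3).
Hypothesis h1_wt : wt_ge (weights3 l m n) (a2 * l).+1 h1.
Hypothesis h3_wt : wt_ge (weights3 l m n) (b2 * m).+1 h3.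

Let X := varX ix a1.
Let Y := varX iy b1.
Let z := varX iz 1.
Let e := varX ix a2 - h1.
Let v := varX iy b2 - h3.
Let F1 := X * e - Y * z ^+ c2.
Let F2 := Y * v - z ^+ c1 * e.
Let F3 := X * v - z ^+ (c1 + c2).

Hypotheses (V1 : vanishes phi F1) (V2 : vanishes phi F2) (V3 : vanishes phi F3).

Lemma wt_ge_raise_x (f : fpser 3 K) d :
  wt_ge (weights3 l m n) d f -> wt_ge (weights3 l.+1 m n) d f.
Proof. by move=> F M h; apply: F; move: h; rewrite !wt_weights3 mulSn; lia. Qed.

(** Divide by the three minors, with leads y^b1 z^c2, y^b and z^c. For the
    weights (l, m, n) each binomial is homogeneous, so no lead would be
    singled out; with l + 1 in place of l the leads are lighter than their
    tails, because the other term of each binomial is divisible by x. The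
    terms x^p y^i z^j of the remainder have standard y^i z^j, hence
    distinct weights l p + m i + n j, so a remainder that vanishes on the
    curve is zero. *)
Lemma curve_ideal_gens f : convergent abs f -> vanishes phi f ->
  exists q1 q2 q3, [/\ convergent abs q1, convergent abs q2, convergent abs q3 &
    f = q1 * F1 + q2 * F2 + q3 * F3].
Proof.
move=> cf Vf.
have [sa sb sc] := herzog_sums l_gt0 m_gt0 n_gt0 H1.
case: (H1) => ma mb mc ea eb ec [a1p a2p] [b1p b2p] [c1p c2p].
pose om := weights3 l.+1 m n.
pose mu := tnth [tuple (U_(iy) *+ b1 + U_(iz) *+ c2)%MM; (U_(iy) *+ b)%MM;
  (U_(iz) *+ c)%MM].
pose g := tnth [tuple X * e; Y * h3 + z ^+ c1 * e; X * v].
pose sel (M : 'X_{1..3}) := [pick j | (mu j <= M)%MM].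
have [o0 o1 o2] : [/\ om ix = l.+1, om iy = m & om iz = n] by [].
have om_gt0 j : (0 < om j)%N by elim/I3_ind: j.
have sel_le M j : sel M = Some j -> (mu j <= M)%MM.
  by rewrite /sel; case: pickP => // k h [<-].
have wX : wt_ge om (a1 * l).+1 X.
  by apply: (wt_ge_leq _ (@wt_ge_varX _ om ix a1));
    rewrite ?o0 ?o1 ?o2 mulSn mulnC; lia.
have wY : wt_ge om (b1 * m) Y.
  by apply: (wt_ge_leq _ (@wt_ge_varX _ om iy b1)); rewrite mulnC.
have wz k : wt_ge om (k * n) (z ^+ k).
  by rewrite -varX_exp; apply: (wt_ge_leq _ (@wt_ge_varX _ om iz k));
    rewrite mulnC.
have we : wt_ge om (a2 * l).+1 e.
  apply: wt_geD; last by apply: wt_geN; apply: wt_ge_raise_x.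
  by apply: (wt_ge_leq _ (@wt_ge_varX _ om ix a2));
    rewrite ?o0 ?o1 ?o2 mulSn mulnC; lia.
have wv : wt_ge om (b2 * m) v.
  apply: wt_geD; last by apply: wt_geN; apply: wt_ge_raise_x;
    apply: (wt_ge_leq _ h3_wt).
  by apply: (wt_ge_leq _ (@wt_ge_varX _ om iy b2)); rewrite mulnC.
have g_wt j : wt_ge om (wt om (mu j)).+1 (g j).
  elim/I3_ind: j.
  - rewrite /mu [tnth _ _]/= wtD !wt_U.
    apply: (wt_ge_leq _ (wt_geM wX we)); rewrite ?o0 ?o1 ?o2.
    by move: ea; rewrite sa mulnDl; lia.
  - rewrite /mu [tnth _ _]/= wt_U; apply: wt_geD.
      apply: (wt_ge_leq _ (wt_geM wY (wt_ge_raise_x h3_wt))); rewrite ?o0 ?o1 ?o2.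
      by rewrite sb mulnDr; lia.
    apply: (wt_ge_leq _ (wt_geM (wz c1) we)); rewrite ?o0 ?o1 ?o2.
    by move: eb; lia.
  - rewrite /mu [tnth _ _]/= wt_U.
    apply: (wt_ge_leq _ (wt_geM wX wv)); rewrite ?o0 ?o1 ?o2.
    by move: ec; lia.
have cpw i k : convergent abs (varX i k : fpser 3 K) by exact: convergent_mpoly.
have cX : convergent abs X by exact: cpw.
have cY : convergent abs Y by exact: cpw.
have cz k : convergent abs (z ^+ k) by rewrite -varX_exp; exact: cpw.
have ce : convergent abs e by apply: convergentB.
have cv : convergent abs v by apply: convergentB.
have g_conv j : convergent abs (g j).
  elim/I3_ind: j.
  - exact: (convergentM cX ce).
  - exact: (convergentD (convergentM cY h3_conv) (convergentM (cz c1) ce)).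
  - exact: (convergentM cX cv).
have [q [rem [cq crem E remP]]] := division om_gt0 sel_le g_wt g_conv
  (S := fun _ => True) cf (fun _ _ => I) (fun _ _ _ _ _ _ => I).
have E1 : fps_mono K (mu ix) - g ix = - F1.
  rewrite -[LHS]/(fps_mono K
    (U_(iy) *+ b1 + U_(iz) *+ c2)%MM - X * e) fps_monoD.
  by rewrite -/(varX iy b1) -/(varX iz c2) [varX iz c2]varX_exp opprB.
have E2 : fps_mono K (mu iy) - g iy = F2.
  rewrite -[LHS]/(varX iy b - (Y * h3 + z ^+ c1 * e)) sb varXD -/Y /F2 /v.
  by rewrite [Y * (_ - _)]mulrBr [- (Y * h3 + _)]opprD addrA.
have E3 : fps_mono K (mu iz) - g iz = - F3.
  by rewrite -[LHS]/(varX iz c - X * v) sc varX_exp opprB.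
have {}E : f = (- q ix) * F1 + q iy * F2 + (- q iz) * F3 + rem.
  by rewrite {1}E big_I3 /= E1 E2 E3; ring.
exists (- q ix), (q iy), (- q iz); split=> //.
- by rewrite -[- _]sub0r; apply: convergentB => //; rewrite -(subrr f);
  apply: convergentB.
- by rewrite -[- _]sub0r; apply: convergentB => //; rewrite -(subrr f);
  apply: convergentB.
rewrite {1}E (_ : rem = 0) ?addr0 //.
have VD := vanishesD weights3_gt0 phiP; have VM := vanishesM weights3_gt0 phiP.
apply: (vanishes_sep weights3_gt0 D_gt0 phiP); last first.
  have -> : rem = f + (q ix * F1 + (- q iy) * F2 + q iz * F3) by rewrite {1}E;
    ring.
  by apply: (VD) => //; apply: (VD); [apply: (VD)|]; exact: VM.
have std M : rem M != 0 -> standard b c b1 c2 (M iy) (M iz).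
  move=> /remP[_]; rewrite /sel; case: pickP => // no _; apply/and3P; split.
  - by have := no iy; rewrite /mu [tnth _ _]/= lem_U ltnNge => ->.
  - by have := no iz; rewrite /mu [tnth _ _]/= lem_U ltnNge => ->.
  - apply/negP => /andP[hb hc]; have := no ix; rewrite /mu [tnth _ _]/=.
    move/negP; apply; apply/mnm_lepP; elim/I3_ind;
      rewrite mnmDE !mulmnE !mnm1E /=; lia.
move=> M M' rM rM'; rewrite !wt_weights3 => eqw.
have [|||e0 e1 e2] := @standard_weight_inj l m n a b c a1 a2 b1 b2 c1 c2 l_gt0
  m_gt0 n_gt0 H1
  (M ix) (M iy) (M iz) (M' ix) (M' iy) (M' iz).
- exact: std.
- exact: std.
- by rewrite ![(_ * l)%N]mulnC ![(_ * m)%N]mulnC ![(_ * n)%N]mulnC.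
by apply/mnmP; elim/I3_ind.
Qed.
End SpaceCurve.

(** * The deformed monomial curve *)

Section CurveGerm.
Local Open Scope ring_scope.

Lemma near_mono_deformation (K : fieldType) l (Dl : enat)
    (p : {poly {poly K}}) D :
  monomial_deformation l Dl p -> enat_le (Some D) Dl -> near_mono l D (at_s1 p).
Proof.
move=> [N [c ->]] hD.
exists (\sum_(i < N | enat_le (enat_addl l Dl) (Some (nat_of_ord i)))
          c i *: 'X^(i - l - D)).
rewrite /at_s1 rmorphD /= map_polyXn mulrDr mulr1; congr (_ + _).
rewrite rmorph_sum mulrA -exprD mulr_sumr; apply: eq_bigr => i /= hi.
rewrite map_polyZ /= map_polyXn /horner_eval hornerZ hornerXn expr1n mulr1.
rewrite -scalerAr -exprD; congr (_ *: 'X^_).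
by case: Dl hD hi => //= d hD hi; lia.
Qed.

Section Convergent.
Variables (n : nat) (K : fieldType) (R : realType) (abs : absvalue K R).
Implicit Types f g : cpser n abs.

Lemma cps_valD f g : cps_val (f + g) = cps_val f + cps_val g. Proof. by []. Qed.
Lemma cps_valB f g : cps_val (f - g) = cps_val f - cps_val g. Proof. by []. Qed.
Lemma cps_valM f g : cps_val (f * g) = cps_val f * cps_val g. Proof. by []. Qed.
Lemma cps_valX f k : cps_val (f ^+ k) = cps_val f ^+ k.
Proof. by elim: k => // k IH; rewrite !exprS cps_valM IH. Qed.

Lemma cps_val_inj : injective (@cps_val n K R abs).
Proof. exact: val_inj. Qed.

Lemma cps_conv f : convergent abs f.
Proof. exact: asboolW (valP f). Qed.

Definition cps_mk (f : fpser n K) (cf : convergent abs f) : cpser n abs :=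
  CPSer (asboolT cf : f \in convergent_pred abs).
End Convergent.

Lemma space_curve_idealP (K : fieldType) (R : realType) (abs : absvalue K R)
    (xi eta zeta : {poly K}) (f : cpser 3 abs) :
  space_curve_ideal abs xi eta zeta f <->
  vanishes (tnth [tuple xi; eta; zeta]) f.
Proof.
split=> [E i|V]; last by apply: fpserP => d; rewrite fps_subst_coefE V.
have := congr1 (fun g : fpser 1 K => g (U_(ord0) *+ i)%MM) E.
by rewrite fps_subst_coefE mdegMn mdeg1 mul1n.
Qed.

(** Modulo t^(D + d) with d = a l or d = c n, both monomials of the first
    or third Herzog binomial take the same value t^d on the curve. So the
    binomials have order at least gamma + a1 l there and can be corrected
    by multiples of x^a1, which gives the minors F1 and F3. *)
Theorem deformed_monomial_curve_stci (K : fieldType) (R : realType)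
    (abs : absvalue K R) (l m n a b c a1 a2 b1 b2 c1 c2 gamma D : nat)
    (xi eta zeta : {poly K}) :
  (0 < l)%N -> (0 < m)%N -> (0 < n)%N -> (0 < D)%N ->
  herzog_H1 l m n a b c a1 a2 b1 b2 c1 c2 ->
  is_conductor (semigroup3 l m n) gamma ->
  near_mono l D xi -> near_mono m D eta -> near_mono n D zeta ->
  (gamma + a1 * l <= a * l + D)%N -> (gamma + a1 * l <= c * n + D)%N ->
  set_theoretic_ci (space_curve_ideal abs xi eta zeta).
Proof.
move=> l0 m0 n0 D0 H1 cond dxi deta dzeta Hd1 Hd3.
have [sa sb sc] := herzog_sums l0 m0 n0 H1.
have g0 := conductor_gt0 l0 m0 n0 H1 cond.
case: (H1) => _ _ _ ea eb ec [a1p a2p] [b1p b2p] [c1p c2p].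
pose w := weights3 l m n; pose phi := tnth [tuple xi; eta; zeta].
have w0 : forall j, (0 < w j)%N by exact: weights3_gt0.
have phiP j : near_mono (w j) D (phi j) by elim/I3_ind: j.
have gammaP i : (gamma <= i)%N -> exists M : 'X_{1..3}, wt w M = i.
  move=> /cond.1[u1 [u2 [u3 ->]]].
  exists (U_(ix) *+ u1 + U_(iy) *+ u2 + U_(iz) *+ u3)%MM.
  by rewrite !wtD !wt_U -[w ix]/l -[w iy]/m -[w iz]/n; lia.
(* For monomials M1, M3 of the same weight d, the series f below is
   M1 - M3 - h x^a1; only the order of M1 - M3 on the curve matters. *)
have correction M1 M3 d :
    wt w M1 = d -> wt w M3 = d -> (gamma + a1 * l <= d + D)%N ->
    exists h, [/\ convergent abs h, wt_ge w (d.+1 - a1 * l) h &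
      forall f, f + h * varX K ix a1 = fps_of_mpoly ('X_[M1] - 'X_[M3]) ->
      vanishes phi f].
  move=> w1 w2 hd; pose p := msubst phi ('X_[M1] - 'X_[M3]).
  have [|i|h [ch wh eh]] := representation w0 D0 phiP abs
     (x0 := ix) (gamma := gamma) (kappa := a1)
     (w0 := maxn d.+1 (gamma + a1 * l)) (p := p) g0 gammaP.
  - exact: leq_maxr.
  - move=> hi; rewrite /p msubstB coefB !(msubstX_coef phiP) ?w1 ?w2 ?subrr //;
    lia.
  exists h; split=> // [|f E i].
    by apply: (wt_ge_leq _ wh); apply: leq_sub2r; exact: leq_maxl.
  apply: (@addIr _ (subst_coef phi (h * varX K ix a1) i)).
  by rewrite -(subst_coefD w0 phiP) E (subst_coef_mpoly w0 phiP) eh add0r.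
have wxa : wt w (U_(ix) *+ a)%MM = (a * l)%N by rewrite wt_U mulnC.
have wyz : wt w (U_(iy) *+ b1 + U_(iz) *+ c2)%MM = (a * l)%N.
  by rewrite wtD !wt_U -[w iy]/m -[w iz]/n ea; lia.
have wxy : wt w (U_(ix) *+ a1 + U_(iy) *+ b2)%MM = (c * n)%N.
  by rewrite wtD !wt_U -[w ix]/l -[w iy]/m ec; lia.
have wzc : wt w (U_(iz) *+ c)%MM = (c * n)%N by rewrite wt_U mulnC.
have [h1 [ch1 wh1 V1]] := correction _ _ _ wxa wyz Hd1.
have [h3 [ch3 wh3 V3]] := correction _ _ _ wxy wzc Hd3.
pose X := varX K ix a1; pose Y := varX K iy b1; pose z := varX K iz 1.
pose e := varX K ix a2 - h1; pose v := varX K iy b2 - h3.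
pose F1 := X * e - Y * z ^+ c2; pose F2 := Y * v - z ^+ c1 * e.
pose F3 := X * v - z ^+ (c1 + c2).
have vF1 : vanishes phi F1.
  apply: V1; rewrite fps_of_mpolyB -!/(fps_mono K _) fps_monoD.
  rewrite -[fps_mono K (U_(ix) *+ a)%MM]/(varX K ix a) sa varXD.
  rewrite -[fps_mono K (U_(iy) *+ b1)%MM]/Y -[fps_mono K
    (U_(iz) *+ c2)%MM]/(varX K iz c2).
  by rewrite [varX K iz c2]varX_exp -/X -/z /F1 /e;
    move: (X) (Y) (z ^+ c2) => X' Y' Z; ring.
have vF3 : vanishes phi F3.
  apply: V3; rewrite fps_of_mpolyB -!/(fps_mono K _) fps_monoD.
  rewrite -[fps_mono K (U_(ix) *+ a1)%MM]/X -[fps_mono K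
    (U_(iy) *+ b2)%MM]/(varX K iy b2).
  rewrite -[fps_mono K (U_(iz) *+ c)%MM]/(varX K iz c) [varX K iz c]varX_exp
    -/z sc.
  by rewrite /F3 /v -/X; move: (X) (z ^+ _) => X' Z; ring.
have VD := vanishesD w0 phiP; have VM := vanishesM w0 phiP.
have nvX : ~ vanishes phi X.
  move=> /(_ (wt w (U_(ix) *+ a1)%MM)) /eqP.
  rewrite /X /varX /fps_mono (subst_coef_mpoly w0 phiP)
    (msubstX_coef phiP) ?eqxx ?oner_eq0 //.
  by rewrite -[X in (X < _)%N]addn0 ltn_add2l.
have cancelX f : vanishes phi (X * f) -> vanishes phi f.
  by move=> /(vanishes_prime w0 D0 phiP)[].
have vF2 : vanishes phi F2.
  (* A syzygy of the matrix; X does not vanish on the curve. *)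
  apply: cancelX; have -> : X * F2 = Y * F3 + (- z ^+ c1) * F1.
    rewrite /F1 /F2 /F3 exprD.
    by move: (X) (Y) (z ^+ c1) (z ^+ c2) (e) (v) => X' Y' Z1 Z2 e' v'; ring.
  by apply: VD; exact: VM.
have cpw i k : convergent abs (varX K i k : fpser 3 K)
  by exact: convergent_mpoly.
pose mX := cps_mk (cpw ix a1); pose mY := cps_mk (cpw iy b1);
  pose mz := cps_mk (cpw iz 1%N).
pose me := cps_mk (convergentB (cpw ix a2) ch1);
  pose mv := cps_mk (convergentB (cpw iy b2) ch3).
have [E1 E2 E3] : [/\ cps_val (mX * me - mY * mz ^+ c2) = F1,
    cps_val (mY * mv - mz ^+ c1 * me) = F2 &
    cps_val (mX * mv - mz ^+ (c1 + c2)) = F3].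
  by rewrite !cps_valB !cps_valM !cps_valX.
have P := @space_curve_idealP K R abs xi eta zeta.
apply: (determinantal_stci c1p c2p (X := mX) (Y := mY) (z := mz) (e := me)
  (v := mv)).
- split=> [f g /P Vf /P Vg|r f /P Vf]; apply/P; first by rewrite cps_valD;
  exact: VD.
  by rewrite cps_valM; exact: VM.
- by apply/P; rewrite E1.
- by apply/P; rewrite E2.
- by apply/P; rewrite E3.
- move=> f /P Vf.
  have wh1' : wt_ge w (a2 * l).+1 h1 by apply: (wt_ge_leq _ wh1);
    rewrite sa mulnDl; lia.
  have wh3' : wt_ge w (b2 * m).+1 h3 by apply: (wt_ge_leq _ wh3); rewrite ec;
    lia.
  have [q1 [q2 [q3 [cq1 cq2 cq3 E]]]] := curve_ideal_gens l0 m0 n0 H1 D0 phiP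
    ch1 ch3 wh1' wh3' vF1 vF2 vF3 (cps_conv f) Vf.
  exists (cps_mk cq1), (cps_mk cq2), (cps_mk cq3); apply: cps_val_inj.
  by rewrite !cps_valD !(cps_valM (cps_mk _)) E1 E2 E3.
- by move=> f /P; rewrite cps_valM => Vf; apply/P; apply: cancelX.
- move=> f k /P; rewrite cps_valX => Vf; apply/P; elim: k Vf => [|k IH].
    by rewrite expr0 => V0; rewrite -[cps_val f]mulr1; exact: VM.
  by rewrite exprS => /(vanishes_prime w0 D0 phiP)[|/IH].
Qed.
End CurveGerm.

(** * Orders of deformation and the main result *)

Section ExtendedNat.
Local Open Scope nat_scope.

Lemma enat_le_min (x y z : enat) :
  enat_le x (enat_min y z) = enat_le x y && enat_le x z.
Proof.
by rewrite /enat_min; case: x y z => [x|] [y|] [z|] //=;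
  rewrite ?andbT //; case: ifP => /=; lia.
Qed.

(** If x is infinite, every D is admissible and a large one will do. *)
Lemma enat_finite_order (g d : nat) (x : enat) :
  enat_le (Some 1) x -> enat_le (Some g) (enat_addl d x) ->
  exists D, [/\ 0 < D, g <= d + D & enat_le (Some D) x].
Proof.
by case: x => [D|] /= h1 h2; [exists D|exists g.+1; split=> //; lia].
Qed.
End ExtendedNat.

Theorem proposition4p2
    (R : realType) (K : closedFieldType) (abs : absvalue K R)
    (abs_nontriv : absv_nontrivial abs) (abs_compl : absv_complete abs)
    (l m n : nat) (l_gt0 : 0 < l) (m_gt0 : 0 < m) (n_gt0 : 0 < n)
    (gcd_lmn : gcdn l (gcdn m n) = 1)
    (a b c a1 a2 b1 b2 c1 c2 : nat)
    (H1 : herzog_H1 l m n a b c a1 a2 b1 b2 c1 c2)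
    (gamma : nat) (gamma_cond : is_conductor (semigroup3 l m n) gamma)
    (Dl Dm Dn : enat)
    (Dl_ge1 : enat_le (Some 1) Dl) (Dm_ge1 : enat_le (Some 1) Dm)
    (Dn_ge1 : enat_le (Some 1) Dn)
    (xi eta zeta : {poly {poly K}})
    (xi_def : monomial_deformation l Dl xi)
    (eta_def : monomial_deformation m Dm eta)
    (zeta_def : monomial_deformation n Dn zeta) :
  let d1 := a * l in
  let d2 := b * m in
  let d3 := c * n in
  let delta := enat_min Dl (enat_min Dm Dn) in
  let k := a1 * c2 in
  let cond :=
    enat_le (Some gamma) (enat_addl (minn d1 (minn d2 d3)) delta) /\
    enat_le (Some (gamma + k * l)) (enat_addl (minn d1 d3) delta) in
  let cond' :=
    enat_le (Some (gamma + k * l))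
      (enat_addl (minn d1 (minn (d2 + k * l) d3)) delta) in
  (cond <-> cond') /\
  (cond ->
   set_theoretic_ci
     (space_curve_ideal abs (at_s1 xi) (at_s1 eta) (at_s1 zeta))).
Proof.
move=> d1 d2 d3 delta k cond cond'.
split; first by rewrite /cond /cond'; move: (delta) => [d|] /=; lia.
move=> [_ cond2]; have c2_gt0 := proj2 (H1_c_pos H1).
have le_k : a1 * l <= k * l by rewrite leq_mul2r leq_pmulr ?orbT.
have delta_ge1 : enat_le (Some 1) delta by rewrite !enat_le_min Dl_ge1 Dm_ge1.
have [D [D_gt0 hD]] := enat_finite_order delta_ge1 cond2.
rewrite !enat_le_min => /andP[Dl_ge /andP[Dm_ge Dn_ge]].
apply: (deformed_monomial_curve_stci
  (D := D) abs l_gt0 m_gt0 n_gt0 D_gt0 H1 gamma_cond).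
- exact: near_mono_deformation xi_def Dl_ge.
- exact: near_mono_deformation eta_def Dm_ge.
- exact: near_mono_deformation zeta_def Dn_ge.
- by apply: leq_trans (leq_trans hD _);
  rewrite ?leq_add2l // leq_add2r geq_minl.
- by apply: leq_trans (leq_trans hD _);
  rewrite ?leq_add2l // leq_add2r geq_minr.
Qed.
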